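(* Let $\mathcal{F}\subset\partial_P\Omega$ be the collection of all non-singleton prime ends of $\Omega$ together with all rectifiably inaccessible singleton prime ends of $\Omega$, i.e. $\mathcal{F}=\partial_P\Omega\setminus\partial_{RSP}\Omega$. Then $\overline{C}^P_p(\mathcal{F})=0$.
   Context: Standing assumptions: $1<p<\infty$; $(X,d,\mu)$ is a complete metric measure space, $\mu$ is a doubling Radon measure ($0<\mu(B(x,2r))\le C\mu(B(x,r))<\infty$), and $X$ supports a $p$-Poincaré inequality; consequently $X$ is proper and quasiconvex (any two points are joined by a rectifiable curve of length at most a constant times their distance), so every domain in $X$ is rectifiably connected. $\Omega\subsetneq X$ is a bounded domain with $C_p(X\setminus\Omega)>0$, satisfying the following assumption: every collection of ends of $\Omega$ that is totally ordered by division has a lower bound, i.e. there is an end dividing every member of the collection. Prime ends: The Mazurkiewicz metric on $\Omega$ is $d_M(x,y)=\inf\operatorname{diam}(E)$, the infimum over compact connected $E\subset\Omega$ containing $x,y$; $\operatorname{dist}_M(A,K)=\inf\{d_M(x,y):x\in A,y\in K\}$. An acceptable set is a connected set $E\subsetneq\Omega$ with $\overline E\cap\partial\Omega\neq\emptyset$. A chain is a sequence $\{E_k\}_{k\ge1}$ of acceptable sets with $E_{k+1}\subset E_k$, $\operatorname{dist}_M(\Omega\cap\partial E_{k+1},\Omega\cap\partial E_k)>0$ for all $k$, and impression $\bigcap_k\overline{E_k}\subset\partial\Omega$. A chain $\{E_k\}$ divides $\{F_k\}$ if for each $k$ there is $l_k$ with $E_{l_k}\subset F_k$; two chains are equivalent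 if each divides the other; an end $[E_k]$ is an equivalence class, and its impression $I[E_k]$ is the impression of any representative. Division induces a partial order on ends; a prime end is an end not divisible by any other end. $\partial_P\Omega$ is the set of prime ends, $\partial_{SP}\Omega$ the set of prime ends with singleton impression, and $\overline\Omega^P=\Omega\cup\partial_P\Omega$. A sequence $(x_n)$ in $\Omega$ converges to $[E_k]$ if for every $k$, $x_n\in E_k$ for all sufficiently large $n$. The prime end topology on $\overline\Omega^P$ has basis $\{G,G^P: G\subset\Omega\text{ open}\}$, where $G^P=G\cup\{[E_k]\in\partial_P\Omega:E_n\subset G\text{ for some }n\}$; limits $\lim_{\Omega\ni y\to x}$ and $\liminf_{\Omega\ni y\to x}$ for $x\in\partial_P\Omega$ are taken with respect to this topology. Classification: A prime end $[E_k]\in\partial_{SP}\Omega$ is rectifiably accessible if there is a rectifiable curve $\gamma:[0,1]\to X$ with $\gamma([0,1))\subset\Omega$, $\{\gamma(1)\}=I[E_k]$, and for each $k$ some $t_k\in(0,1)$ with $\gamma((t_k,1))\subset E_k$; otherwise it is rectifiably inaccessible. $\partial_{RSP}\Omega$ denotes the set of rectifiably accessible prime ends. Sobolev notions: A nonnegative Borel $g$ is an upper gradient of $u$ on an open set $U$ if $|u(x)-u(y)|\le\int_\gamma g\,ds$ for every nonconstant rectifiable curve $\gamma$ in $U$ with endpoints $x,y$. $N^{1,p}(U)$ is the space of measurable $u$ with $\|u\|_{N^{1,p}(U)}^p=\int_U|u|^p\,d\mu+\inf_g\int_U g^p\,d\mu<\infty$ (infimum over upper gradients in $U$), modulo functions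 of zero norm. The Sobolev capacity of $E\subset X$ is $C_p(E)=\inf\|u\|^p_{N^{1,p}(X)}$ over $u\in N^{1,p}(X)$ with $u\ge1$ on $E$. The prime end capacity of $E\subset\overline\Omega^P$ is $\overline{C}^P_p(E)=\inf\|u\|^p_{N^{1,p}(\Omega)}$ over all $u\in N^{1,p}(\Omega)$ with $u\ge1$ on $E\cap\Omega$ and $\liminf_{\Omega\ni y\to x}u(y)\ge1$ for all $x\in E\cap\partial_P\Omega$. *)

(* Defs.v *)
From HB Require Import structures.
From mathcomp Require Import all_boot all_order all_algebra.
From mathcomp Require Import all_classical all_reals all_analysis.
From mathcomp Require Import measurable_realfun.
Set Implicit Arguments. Unset Strict Implicit. Unset Printing Implicit Defensive.
Import Order.TTheory GRing.Theory Num.Theory.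
Import numFieldNormedType.Exports.
Local Open Scope classical_set_scope.
Local Open Scope ring_scope.

Section MetricMeasure.
Context {R : realType} {dX : measure_display} {X : measurableType dX}.
Variable dist : X -> X -> R.

Definition is_metric : Prop :=
  (forall x y, 0 <= dist x y) /\ (forall x y, dist x y = 0 <-> x = y) /\
  (forall x y, dist x y = dist y x) /\
  (forall x y z, dist x z <= dist x y + dist y z).

Definition dcomplete : Prop :=
  forall u : nat -> X,
    (forall e, 0 < e -> exists N, forall m n, (N <= m)%N -> (N <= n)%N ->
        dist (u m) (u n) < e) ->
    exists x, forall e, 0 < e -> exists N, forall n, (N <= n)%N -> dist (u n) x < e.

Definition dball (x : X) (r : R) : set X := [set y | dist x y < r].
Definition dopen (A : set X) : Prop :=
  forall x, A x -> exists2 r, 0 < r & dball x r `<=` A.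
Definition dclosure (A : set X) : set X :=
  [set x | forall r, 0 < r -> exists y, A y /\ dist x y < r].
Definition dinterior (A : set X) : set X :=
  [set x | exists2 r, 0 < r & dball x r `<=` A].
Definition dboundary (A : set X) : set X := dclosure A `\` dinterior A.
Definition dbounded (A : set X) : Prop := exists x r, A `<=` dball x r.
Definition dconnected (E : set X) : Prop :=
  forall U V, dopen U -> dopen V -> E `<=` U `|` V -> E `&` U `&` V = set0 ->
    E `&` U = set0 \/ E `&` V = set0.
Definition dcompact (E : set X) : Prop :=
  forall F : set (set X), (forall A, F A -> dopen A) ->
    E `<=` \bigcup_(A in F) A ->
    exists (n : nat) (A : nat -> set X), (forall i, (i < n)%N -> F (A i)) /\
      E `<=` \bigcup_(i in [set i | (i < n)%N]) A i.
Definition diam (E : set X) : \bar R :=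
  ereal_sup [set z | exists x y, E x /\ E y /\ z = (dist x y)%:E].

Definition curve_length (gam : R -> X) (a b : R) : \bar R :=
  ereal_sup [set z | exists (n : nat) (t : nat -> R),
     t 0%N = a /\ t n = b /\ (forall i, (i < n)%N -> t i <= t i.+1) /\
     z = (\sum_(i < n) dist (gam (t i)) (gam (t i.+1)))%:E].
Definition rect_curve01 (gam : R -> X) : Prop :=
  (forall s, 0 <= s <= 1 -> forall e, 0 < e -> exists2 del, 0 < del &
     forall t, 0 <= t <= 1 -> `|t - s| < del -> dist (gam s) (gam t) < e) /\
  (curve_length gam 0 1 < +oo)%E.
Definition arclength_curve (gam : R -> X) (l : R) : Prop :=
  0 < l /\ forall a b, 0 <= a -> a <= b -> b <= l ->
     curve_length gam a b = (b - a)%:E.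

Definition borel_sets : set (set X) := <<s dopen >>.
Definition borel_efun (g : X -> \bar R) : Prop :=
  forall A : set (\bar R), measurable (A : set (\bar R)) -> borel_sets (g @^-1` A).
(* line integral of g along an arc-length parametrized curve gamma:[0,l] -> X *)
Definition line_int (g : X -> \bar R) (gam : R -> X) (l : R) : \bar R :=
  (\int[@lebesgue_measure R]_(s in `[0%R, l]%classic) g (gam s))%E.
Definition upper_gradient (U : set X) (u : X -> R) (g : X -> \bar R) : Prop :=
  (forall x, (0 <= g x)%E) /\ borel_efun g /\
  forall gam l, arclength_curve gam l -> (forall s, 0 <= s <= l -> U (gam s)) ->
    ((`|u (gam 0) - u (gam l)|)%:E <= line_int g gam l)%E.

Variable mu : {measure set X -> \bar R}.
Variable p : R.

Definition completed_borel : Prop :=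
  forall A, measurable A <-> exists B1 B2, borel_sets B1 /\ borel_sets B2 /\
     B1 `<=` A /\ A `<=` B2 /\ mu (B2 `\` B1) = 0%E.

Definition doubling : Prop :=
  exists C : R, forall x r, 0 < r ->
    (0 < mu (dball x (2 * r)))%E /\ (mu (dball x (2 * r)) <= C%:E * mu (dball x r))%E /\
    (mu (dball x r) < +oo)%E.

Definition avg_int (B : set X) (f : X -> \bar R) : \bar R :=
  ((\int[mu]_(y in B) f y) * ((fine (mu B))^-1)%:E)%E.

Definition poincare : Prop :=
  exists C lam : R, 0 < C /\ 1 <= lam /\
  forall (x : X) (r : R) (u : X -> R) (g : X -> \bar R), 0 < r ->
    measurable_fun setT u ->
    (forall y s, 0 < s -> mu.-integrable (dball y s) (EFin \o u)) ->
    upper_gradient setT u g ->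
    let uB := fine (avg_int (dball x r) (EFin \o u)) in
    (avg_int (dball x r) (fun y => (`|u y - uB|)%:E) <=
      (C * r)%:E * (avg_int (dball x (lam * r)) (fun y => g y `^ p)) `^ (p^-1))%E.

Definition in_N1p (U : set X) (u : X -> R) : Prop :=
  measurable_fun U u /\
  (\int[mu]_(x in U) (`|u x| `^ p)%:E < +oo)%E /\
  exists g, upper_gradient U u g /\ (\int[mu]_(x in U) (g x `^ p) < +oo)%E.

Definition N1p_normp (U : set X) (u : X -> R) : \bar R :=
  (\int[mu]_(x in U) (`|u x| `^ p)%:E +
   ereal_inf [set z | exists g, upper_gradient U u g /\
                             z = \int[mu]_(x in U) (g x `^ p)])%E.

Definition sobolev_cap (E : set X) : \bar R :=
  ereal_inf [set z | exists u, in_N1p setT u /\ (forall x, E x -> 1 <= u x) /\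
                              z = N1p_normp setT u].

Variable Om : set X.

Definition dM (x y : X) : \bar R :=
  ereal_inf [set z | exists E, dcompact E /\ dconnected E /\ E `<=` Om /\
                               E x /\ E y /\ z = diam E].
Definition distM (A K : set X) : \bar R :=
  ereal_inf [set z | exists x y, A x /\ K y /\ z = dM x y].

Definition acceptable (E : set X) : Prop :=
  dconnected E /\ E `<=` Om /\ E <> Om /\ (dclosure E `&` dboundary Om !=set0).

Definition impression (E : nat -> set X) : set X :=
  \bigcap_(k in [set: nat]) dclosure (E k).

Definition chain (E : nat -> set X) : Prop :=
  (forall k, acceptable (E k)) /\ (forall k, E k.+1 `<=` E k) /\
  (forall k, (0 < distM (Om `&` dboundary (E k.+1)) (Om `&` dboundary (E k)))%E) /\
  impression E `<=` dboundary Om.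

Definition divides (E F : nat -> set X) : Prop := forall k, exists l, E l `<=` F k.

(* an end (represented by any of its chains) is prime iff every end dividing it
   is equivalent to it *)
Definition prime_end (E : nat -> set X) : Prop :=
  chain E /\ forall F, chain F -> divides F E -> divides E F.

Definition ends_lower_bound : Prop :=
  forall S : (nat -> set X) -> Prop, (forall E, S E -> chain E) ->
    (forall E F, S E -> S F -> divides E F \/ divides F E) ->
    exists G, chain G /\ forall E, S E -> divides G E.

Definition singleton_impression (E : nat -> set X) : Prop :=
  exists x, impression E = [set x].

Definition rect_accessible (E : nat -> set X) : Prop :=
  exists gam : R -> X, rect_curve01 gam /\ (forall t, 0 <= t < 1 -> Om (gam t)) /\
    impression E = [set gam 1] /\
    forall k, exists t, 0 < t < 1 /\ forall s, t < s < 1 -> E k (gam s).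

Definition RSP_end (E : nat -> set X) : Prop :=
  prime_end E /\ singleton_impression E /\ rect_accessible E.

Definition calF (E : nat -> set X) : Prop := prime_end E /\ ~ RSP_end E.

(* liminf_{Omega \ni y -> [E]} u(y) in the prime end topology: the basic
   neighbourhoods of [E] are the G^P with G open in Omega and E_n in G *)
Definition pe_liminf (u : X -> R) (E : nat -> set X) : \bar R :=
  ereal_sup [set z | exists G, dopen G /\ G `<=` Om /\ (exists n, E n `<=` G) /\
                              z = ereal_inf [set (u y)%:E | y in G]].

Definition pe_cap (Fam : (nat -> set X) -> Prop) : \bar R :=
  ereal_inf [set z | exists u, in_N1p Om u /\
     (forall E, Fam E -> (1 <= pe_liminf u E)%E) /\ z = N1p_normp Om u].

End MetricMeasure.

(* Main.v *)
(** Choose a weight [h >= 0] on [Om] with [h^p] integrable and [h -> oo] at the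
    boundary, and let [D x] be the infimum of the [h]-lengths of curves in [Om] from
    a base point to [x].  The Poincare inequality makes the space quasiconvex, so [D]
    is finite and continuous on [Om], and [min (1, D / n)] has upper gradient [h / n];
    its Sobolev norm tends to [0].

    It remains to see that [D -> oo] along every end [[E_k]] in [calF].  Otherwise
    there are [x_k] in [E_k] with [D (x_k)] bounded.  Since [h] is large near the
    boundary, each [x_k] is joined inside [Om] by a short curve to a fixed compact
    part of [Om]; a compactness argument then gives a subsequence whose consecutive
    points are joined by curves of summable length.  Their concatenation is a
    rectifiable curve ending at a boundary point [z] and with tails in every [E_k],
    because crossing from [E_{k+1}] out of [E_k] costs a definite diameter.  The
    components of [Om] in small balls around [z] that contain the tails form a chain
    dividing [[E_k]], so primality shrinks the impression of [[E_k]] to [z]: the end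
    is rectifiably accessible after all. *)

Require Import Defs.
From mathcomp Require Import all_boot all_order all_algebra.
From mathcomp Require Import all_classical all_reals all_analysis.
From mathcomp Require Import measurable_realfun ring lra.
Set Implicit Arguments. Unset Strict Implicit. Unset Printing Implicit Defensive.
Import Order.TTheory GRing.Theory Num.Theory.
Import numFieldNormedType.Exports.
Local Open Scope classical_set_scope.
Local Open Scope ring_scope.

(** * Metric topology, 1-Lipschitz curves, and the diameter needed to cross a boundary *)

Section MetricTools.
Context {R : realType} {dX : measure_display} {X : measurableType dX}.
Variable dist : X -> X -> R.
Hypothesis metricd : is_metric dist.

Lemma dist_ge0 x y : 0 <= dist x y.
Proof. by case: metricd => + _; exact. Qed.

Lemma dist_eq0 x y : dist x y = 0 -> x = y.
Proof. by case: metricd => _ [+ _] => /(_ x y) [+ _]; exact. Qed.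

Lemma distxx x : dist x x = 0.
Proof. by case: metricd => _ [+ _] => /(_ x x) [_ +]; exact. Qed.

Lemma distC x y : dist x y = dist y x.
Proof. by case: metricd => _ [_ [+ _]]; exact. Qed.

Lemma dist_tri y x z : dist x z <= dist x y + dist y z.
Proof. by case: metricd => _ [_ [_ +]]; exact. Qed.

Lemma dopen_dball x r : dopen dist (dball dist x r).
Proof.
move=> y /= xy; exists (r - dist x y); first by rewrite subr_gt0.
move=> z /= yz; rewrite /dball /=; have := dist_tri y x z; move: yz xy; rewrite /dball /=; lra.
Qed.

Lemma dball_center x r : 0 < r -> dball dist x r x.
Proof. by rewrite /dball /= distxx. Qed.

Lemma dopenI A B : dopen dist A -> dopen dist B -> dopen dist (A `&` B).
Proof.
move=> oA oB x [/oA [r r0 rA] /oB [s s0 sB]].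
exists (Num.min r s); first by rewrite lt_min r0.
move=> y; rewrite /dball /= lt_min => /andP[xr xs]; split; [exact: rA|exact: sB].
Qed.

Lemma dopen_dinterior A : dopen dist (dinterior dist A).
Proof.
move=> x [r r0 rA]; exists r => // y xy.
by have [s s0 sB] := dopen_dball xy; exists s => // z /sB /rA.
Qed.

Lemma dopen_compl_dclosure A : dopen dist (~` dclosure dist A).
Proof.
move=> x /= nA; have [r r0 rA] : exists2 r, 0 < r & forall y, A y -> r <= dist x y.
  apply: contrapT => H; apply: nA => r r0; apply: contrapT => H'.
  apply: H; exists r => // y Ay; rewrite leNgt; apply/negP => xy.
  by apply: H'; exists y.
exists (r / 2); first by rewrite divr_gt0.
move=> y; rewrite /dball /= => xy Ay.
have r20 : 0 < r / 2 by rewrite divr_gt0.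
have [z [Az yz]] := Ay _ r20.
by have := rA z Az; have := dist_tri y x z; lra.
Qed.

Lemma sub_dclosure A : A `<=` dclosure dist A.
Proof. by move=> x Ax r r0; exists x; rewrite distxx. Qed.

Lemma dinterior_sub A : dinterior dist A `<=` A.
Proof. by move=> x [r r0]; apply; exact: dball_center. Qed.

Lemma dclosureS A B : A `<=` B -> dclosure dist A `<=` dclosure dist B.
Proof. by move=> AB x xA r /xA [y [Ay xy]]; exists y; split=> //; exact: AB. Qed.

(** If [K] missed the boundary of [E], the interior of [E] and the complement of its closure would
    be two open sets separating [K]. *)
Lemma connected_meets_boundary K E x y : dconnected dist K ->
  K x -> E x -> K y -> ~ E y -> K `&` dboundary dist E !=set0.
Proof.
move=> cK Kx Ex Ky Ey; apply/set0P/negP => /eqP K0.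
have Kb z : K z -> dboundary dist E z -> False.
  by move=> Kz bz; rewrite -[False]/(set0 z) -K0.
have [] := cK _ _ (@dopen_dinterior E) (@dopen_compl_dclosure E).
- move=> z Kz; have [|nI] := pselect (dinterior dist E z); first by left.
  by right=> cz; exact: (Kb z Kz).
- rewrite -subset0 => z [[_ Iz]] /=; apply; apply: sub_dclosure.
  exact: dinterior_sub.
- rewrite -subset0 => /(_ x); apply; split => //.
  by apply: contrapT => nI; apply: (Kb x Kx); split=> //; exact: sub_dclosure.
- rewrite -subset0 => /(_ y); apply; split => // cy.
  by apply: (Kb y Ky); split => // /dinterior_sub.
Qed.

(** Curves are total functions on the line; a curve given on a segment is extended by constants
    through [clamp], which spares all bookkeeping of domains. *)
Definition lip1 (f : R -> X) := forall s t, dist (f s) (f t) <= `|s - t|.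

Definition clamp (r s : R) : R := Num.max 0 (Num.min r s).

Lemma clamp_id r s : 0 <= s <= r -> clamp r s = s.
Proof. by move=> /andP[s0 sr]; rewrite /clamp min_r// max_r. Qed.

Lemma clamp_itv r s : 0 <= r -> 0 <= clamp r s <= r.
Proof.
move=> r0; rewrite /clamp le_max lexx /=.
by rewrite ge_max r0 ge_min lexx.
Qed.

Lemma clamp_lip r s t : `|clamp r s - clamp r t| <= `|s - t|.
Proof.
rewrite /clamp /Num.max /Num.min.
by do ![case: ifP]; move=> *; rewrite ler_norml; apply/andP; split;
   case: (ler0P (s - t)); lra.
Qed.

Lemma lip1_clamp f r : 0 <= r ->
  (forall s t, 0 <= s <= r -> 0 <= t <= r -> dist (f s) (f t) <= `|s - t|) ->
  lip1 (f \o clamp r).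
Proof.
move=> r0 H s t; rewrite /=; apply: le_trans (clamp_lip r s t).
by apply: H; exact: clamp_itv.
Qed.

Lemma lip1_preimage_open f A : lip1 f -> dopen dist A -> open (f @^-1` A).
Proof.
move=> lf oA; rewrite openE => s /= /oA [r r0 rA].
apply/nbhs_ballP; exists r => //= t; rewrite /ball /= => st.
by apply: rA; rewrite /dball /=; apply: le_lt_trans st; exact: lf.
Qed.

(** Encodes that [x] and [y] are joined inside [U] by a curve of length at most [r]: a 1-Lipschitz
    parametrization may pause, so only an upper bound on the length is recorded. *)
Definition inner (U : set X) x y (r : R) := 0 <= r /\
  exists f, lip1 f /\ (forall s, U (f s)) /\ f 0 = x /\ f r = y.

Lemma inner_of_segment (U : set X) f r : 0 <= r ->
  (forall s t, 0 <= s <= r -> 0 <= t <= r -> dist (f s) (f t) <= `|s - t|) ->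
  (forall s, 0 <= s <= r -> U (f s)) -> inner U (f 0) (f r) r.
Proof.
move=> r0 lf Uf; split => //; exists (f \o clamp r); split; first exact: lip1_clamp.
split; first by move=> s /=; apply: Uf; exact: clamp_itv.
by rewrite /= !clamp_id // ?lexx ?r0.
Qed.

Lemma inner_refl (U : set X) x (r : R) : U x -> 0 <= r -> inner U x x r.
Proof.
by move=> Ux r0; split => //; exists (fun=> x); do !split => // s t; rewrite distxx.
Qed.

Lemma inner_sym (U : set X) x y (r : R) : inner U x y r -> inner U y x r.
Proof.
move=> [r0 [f [lf [Uf [f0 fr]]]]]; split => //; exists (fun s => f (r - s)); split.
  move=> s t; apply: le_trans (lf _ _) _.
  by rewrite distrC (_ : r - t - (r - s) = s - t) //; ring.
by split => //; rewrite subr0 subrr.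
Qed.

Lemma innerS (U V : set X) x y (r : R) : U `<=` V -> inner U x y r -> inner V x y r.
Proof.
by move=> UV [r0 [f [lf [Uf ?]]]]; split => //; exists f; split=> //; split => // s; exact: UV.
Qed.

Lemma lip1_glue f g r : lip1 f -> lip1 g -> f r = g 0 ->
  lip1 (fun t => if t <= r then f t else g (t - r)).
Proof.
move=> lf lg fg.
suff H a b : a <= b ->
    dist (if a <= r then f a else g (a - r)) (if b <= r then f b else g (b - r)) <= b - a.
  move=> a b; have [ab|/ltW ba] := leP a b; first by rewrite distrC ger0_norm ?subr_ge0 // H.
  by rewrite ger0_norm ?subr_ge0 // distC H.
move=> ab; case: (leP a r) => ar; case: (leP b r) => br.
- by rewrite (le_trans (lf _ _))// distrC ger0_norm ?subr_ge0.
- apply: le_trans (dist_tri (f r) _ _) _; rewrite {2}fg.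
  have := lf a r; rewrite distrC ger0_norm ?subr_ge0 // => ?.
  by have := lg 0 (b - r); rewrite distrC ger0_norm; lra.
- by have := le_lt_trans ab (le_lt_trans br ar); rewrite ltxx.
- by rewrite (le_trans (lg _ _))// distrC ger0_norm; lra.
Qed.

Lemma inner_trans (U : set X) x y z (r s : R) :
  inner U x y r -> inner U y z s -> inner U x z (r + s).
Proof.
move=> [r0 [f [lf [Uf [f0 fr]]]]] [s0 [g [lg [Ug [g0 gs]]]]].
split; first exact: addr_ge0.
exists (fun t => if t <= r then f t else g (t - r)).
split; first by apply: lip1_glue => //; rewrite fr.
split; first by move=> t; case: ifP.
rewrite r0; split => //; case: ifPn => [rs|_]; last by rewrite addrAC subrr add0r.
(* If [r + s <= r], the second curve has length zero and the glued curve already ends at [f r]. *)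
have {}s0 : s = 0 by apply/eqP; rewrite eq_le s0 andbT; lra.
by rewrite s0 addr0 fr -gs s0 g0.
Qed.

Lemma inner_le (U : set X) x y (r s : R) : r <= s -> inner U x y r -> inner U x y s.
Proof.
move=> rs H; have -> : s = r + (s - r) by ring.
apply: (inner_trans H); case: H => r0 [f [_ [Uf [_ <-]]]].
by apply: inner_refl => //; rewrite subr_ge0.
Qed.

Lemma inner_mem (U : set X) x y (r : R) : inner U x y r -> U x /\ U y.
Proof. by move=> [_ [f [_ [Uf [<- <-]]]]]. Qed.

(** Within [I] the preimage of [U] is relatively open, and also relatively closed as the complement
    of the preimage of [V]; so it is empty or all of [I]. *)
Lemma dconnected_lip1_image f (I : set R) : is_interval I -> lip1 f ->
  dconnected dist (f @` I).
Proof.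
move=> /connected_intervalP cI lf U V oU oV fUV fUV0.
have [fU0|/set0P [_ [[s Is <-] Us]]] := eqVneq (f @` I `&` U) set0; [by left|right].
have IE : I `&` f @^-1` U = I.
  apply: cI; first by exists s.
    by exists (f @^-1` U) => //; exact: lip1_preimage_open.
  exists (~` (f @^-1` V)); first by apply: open_closedC; exact: lip1_preimage_open.
  rewrite predeqE => t; split => -[It /= Ut]; split => //=.
    move=> Vt; suff : set0 (f t) by [].
    by rewrite -fUV0; split => //; split => //; exists t.
  by have [|] := fUV (f t) (imageP _ It).
rewrite -subset0 => _ [[t It <-] Vt]; rewrite -fUV0; split => //; split; first by exists t.
by move: It; rewrite -IE => -[].
Qed.

Lemma dcompact_lip1_image f a b : lip1 f -> dcompact dist (f @` `[a, b]).
Proof.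
move=> lf F oF cF.
have := @segment_compact R a b; rewrite compact_cover.
move=> /(_ (set X : choiceType) F (fun A => f @^-1` A)) [].
- by move=> A FA; apply: lip1_preimage_open => //; exact: oF.
- by move=> s abs; have [A FA Afs] := cF _ (imageP f abs); exists A.
move=> D DF Dc; exists (size (finmap.enum_fset D)), (nth set0 (finmap.enum_fset D)); split.
  by move=> i iD; have := DF _ (mem_nth set0 iD); rewrite inE.
move=> _ [s abs <-]; have [A /= AD Afs] := Dc _ abs.
by exists (index A (finmap.enum_fset D)) => /=; rewrite ?index_mem ?nth_index.
Qed.

Lemma diam_le K (e : R) : (forall x y, K x -> K y -> dist x y <= e) ->
  (diam dist K <= e%:E)%E.
Proof.
move=> H; apply: ge_ereal_sup => _ [x [y [Kx [Ky ->]]]].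
by rewrite lee_fin H.
Qed.

Lemma dist_le_dM Om x y : ((dist x y)%:E <= dM dist Om x y)%E.
Proof.
apply: le_ereal_inf_tmp => _ [E [_ [_ [_ [Ex [Ey ->]]]]]].
by apply: ereal_sup_ubound; exists x, y.
Qed.

(* A continuum joining a point of [E'] to a point outside [E] meets both
   boundaries, so its diameter is at least the Mazurkiewicz gap between them. *)
Lemma distM_le_crossing Om (E' E K : set X) x y (e : R) :
  E' `<=` E -> dcompact dist K -> dconnected dist K -> K `<=` Om ->
  K x -> E' x -> K y -> ~ E y ->
  (forall u v, K u -> K v -> dist u v <= e) ->
  (distM dist Om (Om `&` dboundary dist E') (Om `&` dboundary dist E) <= e%:E)%E.
Proof.
move=> EE cK nK KO Kx Ex Ky Ey Ke.
have [u [Ku bu]] : K `&` dboundary dist E' !=set0.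
  by apply: (connected_meets_boundary nK Kx Ex Ky) => /EE.
have [v [Kv bv]] : K `&` dboundary dist E !=set0.
  by apply: (connected_meets_boundary nK Kx (EE _ Ex) Ky).
apply: le_trans (diam_le Ke); apply: ge_ereal_inf; exists (dM dist Om u v).
  by exists u, v; split; [split => //; exact: KO|split => //; split => //; exact: KO].
by apply: ereal_inf_lbound; exists K.
Qed.

Lemma inner_crossing Om (E' E U : set X) x y (r e : R) :
  E' `<=` E -> U `<=` Om -> inner U x y r -> E' x -> ~ E y ->
  (forall u v, U u -> U v -> dist u v <= e) ->
  (distM dist Om (Om `&` dboundary dist E') (Om `&` dboundary dist E) <= e%:E)%E.
Proof.
move=> EE UO [r0 [f [lf [Uf [f0 fr]]]]] Ex Ey Ue.
apply: (@distM_le_crossing _ _ _ (f @` `[0, r]) x y) => //.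
- exact: dcompact_lip1_image.
- by apply: dconnected_lip1_image => //; exact: interval_is_interval.
- by move=> _ [s _ <-]; exact: UO.
- by exists 0 => //=; rewrite in_itv /= lexx r0.
- by exists r => //=; rewrite in_itv /= lexx r0.
- by move=> u v [s _ <-] [t _ <-]; exact: Ue.
Qed.

End MetricTools.

(** * Completeness: infinite concatenation of curves, and limits along ultrafilters *)

Section Completeness.
Context {R : realType} {dX : measure_display} {X : measurableType dX}.
Variable dist : X -> X -> R.
Hypothesis metricd : is_metric dist.
Hypothesis completed : dcomplete dist.

Local Notation geo j := ((2^-1 : R) ^+ j).

Lemma geo_gt0 j : 0 < geo j.
Proof. by rewrite exprn_gt0 // invr_gt0. Qed.

Lemma geo_le1 j : geo j <= 1.
Proof. by rewrite exprn_ile1 //; lra. Qed.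

Lemma geo_le i j : (i <= j)%N -> geo j <= geo i.
Proof. by move=> ij; rewrite ler_wiXn2l //; lra. Qed.

Lemma geo_lt (e : R) : 0 < e -> exists j, geo j < e.
Proof.
move=> e0; have h : `|2^-1 : R| < 1 by rewrite ger0_norm; lra.
have /cvgrPdist_lt /(_ e e0) [N _ /(_ N)] := cvg_expr h.
by rewrite /= sub0r normrN ger0_norm ?(ltW (geo_gt0 _)) // => /(_ (leqnn _)) ?; exists N.
Qed.

Lemma geo_lim (u : nat -> X) : (forall i j, (i <= j)%N -> dist (u i) (u j) <= geo i) ->
  exists z, forall i, dist (u i) z <= geo i.
Proof.
move=> H; have [|z zP] := completed (u := u).
  (* Both points are within [geo N.+1] of [u N.+1], and twice that is [geo N]. *)
  move=> e /geo_lt [N Ne]; exists N.+1 => m n Nm Nn.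
  apply: le_lt_trans Ne; apply: le_trans (dist_tri metricd (u N.+1) _ _) _.
  rewrite (distC metricd); have := H _ _ Nm; have := H _ _ Nn; rewrite exprS; lra.
exists z => i; apply/ler_addgt0Pr => e e0; have [N NP] := zP e e0.
have := NP (maxn i N) (leq_maxr _ _); have := H i (maxn i N) (leq_maxl _ _).
have := dist_tri metricd (u (maxn i N)) (u i) z; lra.
Qed.

(** The [j]-th piece is run through during the times from [1 - geo j] to [1 - geo j.+1], so all
    pieces fit into unit time; completeness supplies the endpoint at time 1. *)
Lemma concat_curve (U : set X) (w : nat -> X) :
  (forall j, inner dist U (w j) (w j.+1) (geo j.+1)) ->
  exists gam : R -> X,
    (forall s t, 0 <= s <= 1 -> 0 <= t <= 1 -> dist (gam s) (gam t) <= `|s - t|) /\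
    (forall s, 0 <= s < 1 -> U (gam s)) /\
    (forall j, gam (1 - geo j) = w j).
Proof.
move=> Hw; have /choice [f fP] : forall j, exists f, lip1 dist f /\
  (forall s, U (f s)) /\ f 0 = w j /\ f (geo j.+1) = w j.+1 by move=> j; have [_] := Hw j.
have Uw j : U (w j) by have [_ [Uf [<- _]]] := fP j.
pose T (j : nat) : R := 1 - geo j.
have TS j : T j.+1 = T j + geo j.+1 by rewrite /T exprS; lra.
have Tle i j : (i <= j)%N -> T i <= T j by move=> /geo_le; rewrite /T; lra.
have T1 j : T j < 1 by have := geo_gt0 j; rewrite /T; lra.
(* [g j] consists of the first [j] pieces and agrees with every later [g] up to time [T j]; [gam] is
   the common value. *)
pose fix g (j : nat) : R -> X := if j is j'.+1 then
  fun s => if s <= T j' then g j' s else f j' (s - T j') else fun=> w 0%N.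
have gT j : g j (T j) = w j.
  case: j => [//|j] /=; rewrite leNgt TS ltrDl geo_gt0 /= addrAC subrr add0r.
  by have [_ [_ [_ ->]]] := fP j.
have lg j : lip1 dist (g j).
  elim: j => [|j IH] /=; first by move=> s t; rewrite (distxx metricd).
  have [lf [_ [f0 _]]] := fP j.
  by apply: lip1_glue => //; rewrite f0 gT.
have Ug j s : U (g j s).
  by elim: j s => [|j IH] s //=; case: ifP => // _; have [_ [+ _]] := fP j.
have gst i j s : (i <= j)%N -> s <= T i -> g j s = g i s.
  move=> /subnK <-; elim: (j - i)%N => [//|k IH] sT; rewrite addSn /= ifT; first exact: IH.
  by apply: le_trans sT (Tle _ _ _); exact: leq_addl.
have gst2 i j s : s <= T i -> s <= T j -> g i s = g j s.
  by move=> si sj; case/orP: (leq_total i j) => ij; [symmetry|]; exact: gst.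
have dw i j : (i <= j)%N -> dist (w i) (w j) <= T j - T i.
  move=> ij; rewrite -(gT j) -(gT i) -(gst _ _ _ ij (lexx _)).
  by apply: le_trans (lg _ _ _) _; rewrite distrC ger0_norm ?subr_ge0 ?Tle.
have [z zP] : exists z, forall i, dist (w i) z <= geo i.
  apply: geo_lim => i j ij; apply: le_trans (dw _ _ ij) _.
  by have := geo_gt0 j; rewrite /T; lra.
have exT s : s < 1 -> exists j, s <= T j.
  move=> s1; have [j jP] : exists j, geo j < 1 - s by apply: geo_lt; rewrite subr_gt0.
  by exists j; rewrite /T; lra.
have /choice [gam gamP] : forall s, exists y,
    (forall j, s <= T j -> y = g j s) /\ (1 <= s -> y = z).
  move=> s; have [s1|s1] := leP 1 s.
    exists z; split => // j sT; have := le_lt_trans s1 (le_lt_trans sT (T1 j)).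
    by rewrite ltxx.
  by have [j sj] := exT s s1; exists (g j s); split => // i si; exact: gst2.
(* The estimate at the endpoint is obtained by passing through a late vertex [w j], whose distance
   to [z] is at most [geo j]. *)
have gz s : s <= 1 -> dist (gam s) z <= 1 - s.
  rewrite le_eqVlt => /orP[/eqP ->|s1].
    by have [_ ->//] := gamP 1; rewrite (distxx metricd) subrr.
  have [j0 sj0] := exT s s1.
  apply/ler_addgt0Pr => e /geo_lt [j1 je].
  pose j := maxn j0 j1.
  have sj : s <= T j by apply: le_trans sj0 (Tle _ _ (leq_maxl _ _)).
  have [/(_ j sj) -> _] := gamP s.
  apply: le_trans (dist_tri metricd (w j) _ _) _.
  have := zP j; have := geo_le (leq_maxr j0 j1 : (j1 <= j)%N).
  have := lg j s (T j); rewrite gT distrC ger0_norm ?subr_ge0 // /T.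
  have := geo_gt0 j; lra.
exists gam; split; last split.
- move=> s t; wlog st : s t / s <= t.
    move=> H hs ht; have [st|/ltW ts] := leP s t; first exact: H.
    by rewrite (distC metricd) distrC; exact: H.
  move=> /andP[s0 s1] /andP[t0]; rewrite le_eqVlt => /orP[/eqP t1|t1].
    rewrite {}t1; have [_ -> //] := gamP 1; apply: le_trans (gz _ s1) _.
    by rewrite distrC ger0_norm ?subr_ge0.
  have [j tj] := exT t t1; have sj := le_trans st tj.
  by have [/(_ j sj) -> _] := gamP s; have [/(_ j tj) -> _] := gamP t; exact: lg.
- by move=> s /andP[_ /exT [j sj]]; have [/(_ j sj) -> _] := gamP s; exact: Ug.
- by move=> j; have [/(_ j (lexx _)) -> _] := gamP (T j); exact: gT.
Qed.

Definition tot_bounded (A : set X) := forall e : R, 0 < e ->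
  exists (n : nat) (c : nat -> X), forall x, A x -> exists2 i, (i < n)%N & dist x (c i) < e.

(** Otherwise the ultrafilter would contain the complements of all the [S i], and with them their
    finite intersection, which is empty. *)
Lemma ultra_finite_cover (T : Type) (F : set_system T) (S : nat -> set T) n :
  UltraFilter F -> (forall t, exists2 i, (i < n)%N & S i t) ->
  exists2 i, (i < n)%N & F (S i).
Proof.
move=> UF H; apply: contrapT => nF.
have nFi i : (i < n)%N -> F (~` S i).
  by move=> ni; have [FS|//] := in_ultra_setVsetC (S i) UF; case: nF; exists i.
have : F (\bigcap_(i in `I_n) ~` S i).
  elim: n {H nF} nFi => [|n IH] nFi; first by rewrite II0 bigcap_set0; exact: filterT.
  apply: (@filterS2 _ _ _ (~` S n) (\bigcap_(i in `I_n) ~` S i)).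
  - move=> t nS nSi i /=; rewrite ltnS leq_eqVlt => /orP[/eqP -> //|]; exact: nSi.
  - exact: nFi.
  - by apply: IH => i /ltnW; exact: nFi.
by move=> /filter_ex [t tP]; have [i ni] := H t; exact: tP.
Qed.

(** At each scale the ultrafilter selects one ball of a finite cover. Selected balls at two scales
    share a point, so their centres are Cauchy. One ultrafilter serves arbitrarily many families [u]
    at once, which replaces diagonal extraction of subsequences. *)
Lemma ultralimit (T : Type) (F : set_system T) (A : set X) (u : T -> X) :
  UltraFilter F -> tot_bounded A -> (forall t, A (u t)) ->
  exists z, forall e : R, 0 < e -> F [set t | dist (u t) z < e].
Proof.
move=> UF tbA Au; have /choice [c cP] : forall k, exists c, F [set t | dist (u t) c < geo k.+1].
  move=> k; have [n [c cP]] := tbA _ (geo_gt0 k.+1).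
  have [|i _ Fi] := @ultra_finite_cover _ _ (fun i => [set t | dist (u t) (c i) < geo k.+1]) n UF.
    by move=> t; have [i ni] := cP _ (Au t); exists i.
  by exists (c i).
have [z zP] : exists z, forall i, dist (c i) z <= geo i.
  apply: geo_lim => i j ij.
  have FF : F ([set t | dist (u t) (c i) < geo i.+1] `&` [set t | dist (u t) (c j) < geo j.+1]).
    by apply: filterI; exact: cP.
  have [t [/= ti tj]] := filter_ex FF.
  have := dist_tri metricd (u t) (c i) (c j); rewrite (distC metricd (c i) (u t)).
  have : geo j.+1 <= geo i.+1 by exact: geo_le.
  by move: ti tj; rewrite !exprS; lra.
exists z => e /geo_lt [j je].
apply: filterS (cP j.+1) => t /= tj.
have := dist_tri metricd (c j.+1) (u t) z; have := zP j.+1.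
have := geo_gt0 j; move: tj; rewrite !exprS; lra.
Qed.

End Completeness.

(** * Measurability of open sets and semicontinuous functions; doubling makes balls totally
    bounded *)

Section MeasureTools.
Context {R : realType} {dX : measure_display} {X : measurableType dX}.
Variable dist : X -> X -> R.
Hypothesis metricd : is_metric dist.
Variable mu : {measure set X -> \bar R}.
Hypothesis borelmu : completed_borel dist mu.
Hypothesis doublingmu : doubling dist mu.

Lemma borel_dopen A : dopen dist A -> borel_sets dist A.
Proof. by move=> oA; exact: sub_sigma_algebra. Qed.

Lemma measurable_borel A : borel_sets dist A -> measurable A.
Proof.
by move=> bA; apply/borelmu; exists A, A; rewrite setDv measure0; do !split.
Qed.

Lemma measurable_dopen A : dopen dist A -> measurable A.
Proof. by move=> /borel_dopen /measurable_borel. Qed.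

Lemma measurable_dball x r : measurable (dball dist x r).
Proof. by apply: measurable_dopen; exact: dopen_dball. Qed.

Lemma measurable_fun_of_dopen_gt (D : set X) (u : X -> R) :
  (forall a, dopen dist (D `&` [set x | a < u x])) -> measurable_fun D u.
Proof.
move=> H mD; apply: (measurability _ (RGenOInfty.measurableE R)) => //.
move=> _ [_ [a ->] <-]; have := measurable_dopen (H a); congr (measurable _).
by rewrite predeqE => x /=; rewrite in_itv /= andbT.
Qed.

(** The assumption is lower semicontinuity, which already makes the superlevel sets open. *)
Lemma measurable_fun_dcontinuous (D : set X) (u : X -> R) : dopen dist D ->
  (forall x, D x -> forall e : R, 0 < e -> exists2 del : R, 0 < del &
     forall y, dist x y < del -> u x - e <= u y) -> measurable_fun D u.
Proof.
move=> oD H; apply: measurable_fun_of_dopen_gt => a x [Dx /= ax].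
have [r r0 rD] := oD x Dx.
have e0 : 0 < (u x - a) / 2 by lra.
have [del del0 delP] := H x Dx _ e0.
exists (Num.min r del); first by rewrite lt_min r0.
move=> y; rewrite /dball /= lt_min => /andP[xr xd]; split; first exact: rD.
by have := delP _ xd; rewrite /=; lra.
Qed.

Definition bmass x r := fine (mu (dball dist x r)).

Lemma bmassE x r : 0 < r -> mu (dball dist x r) = (bmass x r)%:E.
Proof.
have [C HC] := doublingmu.
by move=> r0; rewrite /bmass fineK // ge0_fin_numE //; have [_ []] := HC x r r0.
Qed.

Lemma bmass_gt0 x r : 0 < r -> 0 < bmass x r.
Proof.
move=> r0; have [C HC] := doublingmu.
have r20 : 0 < r / 2 by lra.
have [+ _] := HC x _ r20; have -> : 2 * (r / 2) = r by lra.
by rewrite bmassE.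
Qed.

Lemma bmass_le x r y s : 0 < r -> 0 < s -> dball dist x r `<=` dball dist y s ->
  bmass x r <= bmass y s.
Proof.
move=> r0 s0 H; rewrite -lee_fin -!bmassE //.
by apply: le_measure => //; rewrite inE; exact: measurable_dball.
Qed.

Lemma bmass_doubling : exists C, 1 <= C /\ forall x r, 0 < r -> bmass x (2 * r) <= C * bmass x r.
Proof.
have [C HC] := doublingmu; exists (Num.max 1 C); rewrite le_max lexx; split => // x r r0.
have [_ [+ _]] := HC x r r0; rewrite !bmassE ?mulr_gt0 // -EFinM lee_fin => H.
by apply: le_trans H _; rewrite ler_wpM2r ?(ltW (bmass_gt0 _ _)) // le_max lexx orbT.
Qed.

Lemma bmass_doubling_iter C : (forall x r, 0 < r -> bmass x (2 * r) <= C * bmass x r) ->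
  0 <= C -> forall k x r, 0 < r -> bmass x (2 ^+ k * r) <= C ^+ k * bmass x r.
Proof.
move=> HC C0; elim=> [|k IH] x r r0; first by rewrite !mul1r.
rewrite exprS -mulrA; apply: le_trans (HC _ _ _) _; first by rewrite mulr_gt0 ?exprn_gt0.
by rewrite exprS -mulrA; apply: ler_wpM2l => //; exact: IH.
Qed.

Lemma two_expr_gt (x : R) : exists k, x < 2 ^+ k.
Proof.
have [j jP] : exists j, ((2^-1 : R) ^+ j) < (`|x| + 1)^-1.
  by apply: geo_lt; rewrite invr_gt0; have := normr_ge0 x; lra.
exists j; move: jP; rewrite exprVn ltf_pV2 ?posrE ?exprn_gt0 //.
  by have := ler_norm x; lra.
Qed.

(** Greedy choice: as no finite list is an [e]-net of [A], [psi] maps each list to a point of [A] at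
    distance at least [e] from all its members; [s n] lists the first [n] choices. *)
Lemma separated_sequence (A : set X) (e : R) (a : X) :
  ~ (exists (n : nat) (c : nat -> X), forall x, A x -> exists2 i, (i < n)%N & dist x (c i) < e) ->
  exists x : nat -> X, (forall i, A (x i)) /\ forall i j, (i < j)%N -> e <= dist (x j) (x i).
Proof.
move=> H; have /choice [psi psiP] : forall s : seq X, exists x, A x /\
    forall i, (i < size s)%N -> e <= dist x (nth a s i).
  move=> s; apply: contrapT => Hs; apply: H; exists (size s), (nth a s) => x Ax.
  apply: contrapT => Hx; apply: Hs; exists x; split => // i si.
  by rewrite leNgt; apply/negP => xi; apply: Hx; exists i.
pose fix s n := if n is n'.+1 then rcons (s n') (psi (s n')) else [::].
have ss n : size (s n) = n by elim: n => //= n IH; rewrite size_rcons IH.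
have ns i n : (i < n)%N -> nth a (s n) i = psi (s i).
  elim: n => // n IH; rewrite ltnS /= nth_rcons ss => le_in.
  case: ltnP => [/IH //|ni]; have -> : i = n by apply/eqP; rewrite eqn_leq le_in.
  by rewrite eqxx.
exists (fun n => psi (s n)); split; first by move=> i; have [] := psiP (s i).
by move=> i j ij; have [_ /(_ i)] := psiP (s j); rewrite ss ns //; apply.
Qed.

(** An infinite [e]-separated sequence in the ball would yield infinitely many disjoint balls of
    radius [e / 2] inside one ball of finite mass, while doubling bounds their masses below
    uniformly. *)
Lemma tot_bounded_dball a (r : R) : tot_bounded dist (dball dist a r).
Proof.
move=> e e0; apply: contrapT => /(separated_sequence a) [x [xA xe]].
have r0 : 0 < r by have := xA 0%N; rewrite /dball /=; exact: le_lt_trans (dist_ge0 _ _ _).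
have [C [C1 HC]] := bmass_doubling; have C0 : 0 <= C by lra.
have e20 : 0 < e / 2 by lra.
(* After [k] doublings the ball of radius [e / 2] about any [x i] contains the ball of radius
   [r + e] about [a]. *)
have [k kP] := two_expr_gt ((2 * r + e) / (e / 2)).
have {}kP : 2 * r + e < 2 ^+ k * (e / 2) by rewrite -ltr_pdivrMr.
pose M := bmass a (r + e); have M0 : 0 < M by apply: bmass_gt0; lra.
have Ck0 : 0 < C ^+ k by rewrite exprn_gt0 //; lra.
pose B i := dball dist (x i) (e / 2).
have lowB i : M / C ^+ k <= bmass (x i) (e / 2).
  rewrite ler_pdivrMr // mulrC; apply: le_trans (bmass_doubling_iter HC C0 _ _ e20).
  apply: bmass_le; rewrite ?mulr_gt0 ?exprn_gt0 //; first by lra.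
  move=> y; rewrite /dball /=; have := dist_tri metricd a (x i) y.
  by have := xA i; rewrite /dball /= (distC metricd); lra.
have tB n : trivIset `I_n B.
  move=> i j _ _ [y [yi yj]]; apply: contrapT => /eqP ij.
  wlog {ij} ij : i j yi yj / (i < j)%N.
    by move: ij; rewrite neq_ltn => /orP[ij H|ij H]; [exact: (H i j)|exact: (H j i)].
  have := xe _ _ ij; have := dist_tri metricd y (x j) (x i).
  by move: yi yj; rewrite /B /dball /= (distC metricd (x i)); lra.
have sumB n : n%:R * (M / C ^+ k) <= M.
  rewrite -lee_fin -[leRHS]bmassE; last by lra.
  have mB i : measurable (B i) by exact: measurable_dball.
  have mU : measurable (\big[setU/set0]_(i < n) B i) by exact: bigsetU_measurable.
  apply: (@le_trans _ _ (mu (\big[setU/set0]_(i < n) B i))); last first.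
    apply: le_measure; rewrite ?inE //; first exact: measurable_dball.
    rewrite -bigcup_mkord => y [i _]; rewrite /B /dball /=.
    by have := dist_tri metricd (x i) a y; have := xA i; rewrite /dball /=; lra.
  rewrite measure_semi_additive_ord_I //.
  have -> : (n%:R * (M / C ^+ k))%:E = (\sum_(i < n) (M / C ^+ k)%:E)%E.
    by rewrite sumEFin sumr_const card_ord mulr_natl.
  by apply: lee_sum => i _; have := lowB i; rewrite -lee_fin -bmassE.
have [n nP] : exists n, C ^+ k < n%:R by exists (Num.truncn (C ^+ k)).+1; exact: truncnS_gt.
have := sumB n; rewrite mulrA ler_pdivrMr // (mulrC M) ler_pM2r //.
by lra.
Qed.

End MeasureTools.

(** * From the Poincare inequality to a global Lipschitz bound for functions that are 1-Lipschitz at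
    small scales *)

Section Poincare.
Context {R : realType} {dX : measure_display} {X : measurableType dX}.
Variable dist : X -> X -> R.
Hypothesis metricd : is_metric dist.
Variable mu : {measure set X -> \bar R}.
Hypothesis borelmu : completed_borel dist mu.
Hypothesis doublingmu : doubling dist mu.

Lemma dist_le_curve_length gam (a b : R) : a <= b ->
  ((dist (gam a) (gam b))%:E <= curve_length dist gam a b)%E.
Proof.
move=> ab; apply: ereal_sup_ubound; exists 1%N, (fun i => if i is 0%N then a else b).
by do !split => //=; [case|rewrite big_ord1].
Qed.

Lemma arclength_lip gam l : arclength_curve dist gam l ->
  forall s t, 0 <= s <= l -> 0 <= t <= l -> dist (gam s) (gam t) <= `|s - t|.
Proof.
move=> [l0 H] s t; wlog st : s t / s <= t.
  move=> W hs ht; have [st|/ltW ts] := leP s t; first exact: W.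
  by rewrite (distC metricd) distrC; exact: W.
move=> /andP[s0 sl] /andP[t0 tl]; rewrite -lee_fin.
apply: le_trans (dist_le_curve_length gam st) _; rewrite H //.
by rewrite distrC ger0_norm ?subr_ge0.
Qed.

(** Cutting a curve into equal pieces shorter than [eps] makes the small-scale bound apply to each
    piece; the bounds add up to the length. *)
Lemma cst_upper_gradient (u : X -> R) (eps : R) : 0 < eps ->
  (forall y z, dist y z < eps -> `|u y - u z| <= dist y z) ->
  upper_gradient dist setT u (cst 1%E).
Proof.
move=> eps0 ueps; split => //; split.
  move=> A mA; rewrite preimage_cst.
  have [B0 BC _] := smallest_sigma_algebra setT (dopen dist).
  by case: ifP => _; [have := BC _ B0; rewrite setD0|].
move=> gam l gl _; have lip := arclength_lip gl; have [l0 _] := gl.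
rewrite /line_int integral_cst //= lebesgue_measure_itv /= lte_fin l0 mul1e -EFinB lee_fin subr0.
have [n nP] : exists n, l / eps < n.+1%:R by exists (Num.truncn (l / eps)); exact: truncnS_gt.
pose d := l / n.+1%:R.
have d0 : 0 <= d by rewrite divr_ge0 // ltW.
have dn : d * n.+1%:R = l by rewrite divfK.
have de : d < eps by rewrite /d ltr_pdivrMr // mulrC -ltr_pdivrMr.
suff H i : (i <= n.+1)%N -> `|u (gam 0) - u (gam (d * i%:R))| <= d * i%:R.
  by have := H n.+1 (leqnn _); rewrite dn.
elim: i => [_|i IH ni]; first by rewrite mulr0 subrr normr0.
have h j : (j <= n.+1)%N -> 0 <= d * j%:R <= l.
  by move=> jn; rewrite mulr_ge0 //= -dn ler_wpM2l // ler_nat.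
have hd : dist (gam (d * i%:R)) (gam (d * i.+1%:R)) <= d.
  apply: le_trans (lip _ _ (h _ (ltnW ni)) (h _ ni)) _.
  by rewrite distrC -mulrBr -natrB // subSnn mulr1 ger0_norm.
apply: le_trans (ler_distD (u (gam (d * i%:R))) _ _) _.
have := hd; have := IH (ltnW ni); have := ueps _ _ (le_lt_trans hd de).
have -> : d * i.+1%:R = d * i%:R + d by rewrite -natr1 mulrDr mulr1.
by lra.
Qed.

Local Notation m := (bmass dist mu).
Definition bavg (u : X -> R) x r := fine (avg_int mu (dball dist x r) (EFin \o u)).

Definition bounded_by (N : R) (u : X -> R) := forall y, `|u y| <= N.

Lemma integrable_bounded_by (u : X -> R) N x r : 0 < r -> measurable_fun setT u ->
  bounded_by N u -> mu.-integrable (dball dist x r) (EFin \o u).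
Proof.
move=> r0 mu_ Nu; apply: measurable_bounded_integrable.
- exact: measurable_dball.
- by rewrite (bmassE doublingmu) // ltry.
- exact: measurable_funTS.
- by exists N; split; [exact: num_real|move=> M NM y _; apply: le_trans (Nu y) (ltW NM)].
Qed.

Section Averages.
Variables (u : X -> R) (N : R).
Hypotheses (meas_u : measurable_fun setT u) (bound_u : bounded_by N u).

Lemma bavgE x r : 0 < r -> bavg u x r = \int[mu]_(y in dball dist x r) u y / m x r.
Proof.
move=> r0; rewrite /bavg /avg_int fineM //.
apply: integrable_fin_num => //; first exact: measurable_dball.
exact: integrable_bounded_by r0 meas_u bound_u.
Qed.

Lemma integrable_dev c x r : 0 < r ->
  mu.-integrable (dball dist x r) (EFin \o (fun y => `|u y - c|)).
Proof.
move=> r0; apply: (@integrable_bounded_by _ (N + `|c|)) => //.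
  apply: measurableT_comp => //; apply: measurable_funB => //.
by move=> y; rewrite normr_id (le_trans (ler_normB _ _)) // lerD2r.
Qed.

Lemma bavg_dev c x r : 0 < r ->
  `|bavg u x r - c| <= \int[mu]_(y in dball dist x r) `|u y - c| / m x r.
Proof.
move=> r0; have m0 := bmass_gt0 doublingmu x r0; have mB := measurable_dball metricd borelmu x r.
rewrite ler_pdivlMr // -[X in _ * X]ger0_norm ?(ltW m0) // -normrM mulrBl.
rewrite bavgE // divfK ?gt_eqF // -[c * _](Rintegral_cst mu mB) -RintegralB //.
- apply: le_normr_Rintegral => //.
  apply: (@integrable_bounded_by _ (N + `|c|)) => //; first exact: measurable_funB.
  by move=> y; rewrite (le_trans (ler_normB _ _)) // lerD2r.
- exact: integrable_bounded_by r0 meas_u bound_u.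
- exact: (@integrable_bounded_by _ `|c|).
Qed.

Lemma bavg_near c x r e : 0 < r -> (forall y, dball dist x r y -> `|u y - c| <= e) ->
  `|bavg u x r - c| <= e.
Proof.
move=> r0 He; have m0 := bmass_gt0 doublingmu x r0; have mB := measurable_dball metricd borelmu x r.
apply: le_trans (bavg_dev c x r0) _; rewrite ler_pdivrMr // -(Rintegral_cst mu mB).
apply: le_Rintegral => //; first exact: integrable_dev.
exact: (@integrable_bounded_by _ `|e|).
Qed.

(** The deviation from [bavg u x r] has a smaller integral over the smaller ball, and dividing by
    the smaller mass costs at most the factor [K]. *)
Lemma bavg_sub_ball x r y s e K : 0 < r -> 0 < s ->
  dball dist y s `<=` dball dist x r -> m x r <= K * m y s ->
  (avg_int mu (dball dist x r) (fun z => `|u z - bavg u x r|%:E) <= e%:E)%E ->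
  `|bavg u y s - bavg u x r| <= K * e.
Proof.
move=> r0 s0 sub mK; set c := bavg u x r.
have mx0 := bmass_gt0 doublingmu x r0; have my0 := bmass_gt0 doublingmu y s0.
have mBx := measurable_dball metricd borelmu x r; have mBy := measurable_dball metricd borelmu y s.
have iB := integrable_dev c x r0.
have fB : (\int[mu]_(z in dball dist x r) `|u z - c|%:E)%E \is a fin_num.
  exact: integrable_fin_num iB.
rewrite /avg_int -/(m x r) -(fineK fB) -EFinM lee_fin ler_pdivrMr // => He.
apply: le_trans (bavg_dev c y s0) _; rewrite ler_pdivrMr //.
have H : \int[mu]_(z in dball dist y s) `|u z - c| <= \int[mu]_(z in dball dist x r) `|u z - c|.
  rewrite /Rintegral fine_le //.
    by apply: integrable_fin_num (integrable_dev c y s0).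
  apply: ge0_subset_integral => //.
  by have /integrableP [] := iB.
have e0 : 0 <= e.
  rewrite -(pmulr_lge0 _ mx0); apply: le_trans He.
  by apply: fine_ge0; apply: integral_ge0 => z _; rewrite lee_fin.
apply: le_trans H (le_trans He _); rewrite mulrAC mulrC.
by rewrite ler_wpM2r.
Qed.

End Averages.

Variable p : R.
Hypothesis poincarep : poincare dist mu p.

(** The constant 1 is an upper gradient of [u], so its mean oscillation on a ball is at most [C]
    times the radius. Telescoping over halved balls compares [u] with its averages, and averages
    around [y] and [z] are compared at scale [dist y z]. Neither [eps] nor [N] enters the
    constant. *)
Lemma poincare_lipschitz : exists C : R, 0 <= C /\
  forall (u : X -> R) (eps N : R), 0 < eps ->
  (forall y z, dist y z < eps -> `|u y - u z| <= dist y z) ->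
  bounded_by N u -> forall y z, `|u y - u z| <= C * dist y z.
Proof.
have [C [lam [C0 [lam1 HP]]]] := poincarep.
have [K [K1 HK]] := bmass_doubling doublingmu.
(* With [r = dist y z], the averages at radii [r] and [2 * r] differ from the point values by at
   most 2 and 4 times [K * C * r]; the last summand comes from [mid]. *)
exists (6 * (K * C) + 2 * (K * (K * C))); split.
  by rewrite addr_ge0 // !mulr_ge0 //; lra.
move=> u eps N eps0 ueps uN.
have mu_ : measurable_fun setT u.
  apply: (measurable_fun_dcontinuous borelmu) => [x _|x _ e e0]; first by exists 1.
  exists (Num.min e eps); first by rewrite lt_min e0.
  by move=> y; rewrite lt_min => /andP[xe /ueps]; rewrite ler_norml => /andP[_]; lra.
have pB x (r : R) : 0 < r ->
    (avg_int mu (dball dist x r) (fun z => `|u z - bavg u x r|%:E) <= (C * r)%:E)%E.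
  move=> r0; have lr0 : 0 < lam * r by rewrite mulr_gt0 //; lra.
  have := HP x r u (cst 1%E) r0 mu_ _ (cst_upper_gradient eps0 ueps).
  move=> /(_ _) /le_trans; apply; first by move=> y s s0; exact: integrable_bounded_by uN.
  rewrite /avg_int; under eq_integral do rewrite poweR1r.
  rewrite integral_cst; last exact: measurable_dball.
  rewrite mul1e (bmassE doublingmu) // -EFinM /= mulfV ?gt_eqF ?bmass_gt0 //.
  by rewrite powR1 mulr1.
have step x (r : R) : 0 < r -> `|bavg u x (r / 2) - bavg u x r| <= K * (C * r).
  move=> r0; apply: (bavg_sub_ball mu_ uN) => //; first by lra.
  - by move=> z; rewrite /dball /=; lra.
  - have r2 : 0 < r / 2 by lra.
    by have := HK x _ r2; rewrite (_ : 2 * (r / 2) = r) //; lra.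
  - exact: pB.
have KC0 : 0 <= K * C by rewrite mulr_ge0 //; lra.
have tele x (r : R) k : 0 < r ->
    `|bavg u x (r * 2^-1 ^+ k) - bavg u x r| <= 2 * (K * C * r) * (1 - 2^-1 ^+ k).
  move=> r0; elim: k => [|k IH]; first by rewrite expr0 mulr1 !subrr normr0 mulr0.
  apply: le_trans (ler_distD (bavg u x (r * 2^-1 ^+ k)) _ _) _.
  have rk0 : 0 < r * 2^-1 ^+ k by rewrite mulr_gt0 ?geo_gt0.
  have := step x _ rk0; have -> : r * 2^-1 ^+ k / 2 = r * 2^-1 ^+ k.+1 by rewrite exprS; lra.
  have -> : K * (C * (r * 2^-1 ^+ k)) = K * C * r * 2^-1 ^+ k by lra.
  by move: IH; rewrite exprS; lra.
(* As [u] is continuous, averages over small balls converge to [u x] at every point, not merely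
   almost everywhere. *)
have lebesgue x (r : R) : 0 < r -> `|u x - bavg u x r| <= 2 * (K * C * r).
  move=> r0; apply/ler_addgt0Pr => e e0.
  have [k kP] : exists k, (2^-1 : R) ^+ k < Num.min e eps / r.
    by apply: geo_lt; rewrite divr_gt0 // lt_min e0.
  move: kP; rewrite ltr_pdivlMr // mulrC lt_min => /andP[ke keps].
  have rk0 : 0 < r * 2^-1 ^+ k by rewrite mulr_gt0 ?geo_gt0.
  have near : `|bavg u x (r * 2^-1 ^+ k) - u x| <= e.
    apply: (bavg_near mu_ uN) => // y; rewrite /dball /= => xy.
    have xeps := lt_trans xy keps.
    by rewrite distrC (le_trans (ueps _ _ xeps)) // ltW // (lt_trans xy).
  apply: le_trans (ler_distD (bavg u x (r * 2^-1 ^+ k)) _ _) _.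
  rewrite distrC addrC; apply: lerD near.
  apply: le_trans (tele x r k r0) _; rewrite ler_piMr ?mulr_ge0 ?(ltW r0) //.
    by lra.
  by have := geo_gt0 (R := R) k; lra.
move=> y z; have [yz0|yz0] := eqVneq (dist y z) 0.
  by rewrite (dist_eq0 metricd yz0) distxx // mulr0 subrr normr0.
have r0 : 0 < dist y z by rewrite lt_def yz0 dist_ge0.
set r := dist y z in r0 *; have r20 : 0 < 2 * r by lra.
(* The ball of radius [2 * r] about [z] lies in that of radius [4 * r] about [y], two doublings of
   the small ball; hence [K * K]. *)
have mid : `|bavg u y r - bavg u z (2 * r)| <= K * K * (C * (2 * r)).
  apply: (bavg_sub_ball mu_ uN) => //; last exact: pB.
  - move=> w; rewrite /dball /=; have := dist_tri metricd y z w.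
    by rewrite (distC metricd z y) -/r; lra.
  - apply: (@le_trans _ _ (m y (2 * (2 * r)))).
      apply: bmass_le => //; first by lra.
      move=> w; rewrite /dball /=; have := dist_tri metricd z y w.
      by rewrite -/r; lra.
    apply: le_trans (HK _ _ r20) _; rewrite -mulrA ler_wpM2l //; first by lra.
    exact: HK.
have := lebesgue y r r0; have := lebesgue z _ r20; rewrite distrC.
have := ler_distD (bavg u y r) (u y) (u z).
have := ler_distD (bavg u z (2 * r)) (bavg u y r) (u z).
by move: mid; rewrite !mulrA; lra.
Qed.

End Poincare.

(** * Quasiconvexity: short discrete chains and their limit curve *)

Section Quasiconvexity.
Context {R : realType} {dX : measure_display} {X : measurableType dX}.
Variable dist : X -> X -> R.
Hypothesis metricd : is_metric dist.

Inductive eps_chain (eps : R) (x : X) : X -> R -> Prop :=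
| eps_chain0 : eps_chain eps x x 0
| eps_chainS y z c : eps_chain eps x y c -> dist y z < eps ->
    eps_chain eps x z (c + dist y z).

Lemma eps_chain_ge0 eps x y c : eps_chain eps x y c -> 0 <= c.
Proof. by elim=> // {}y z {}c _ c0 _; rewrite addr_ge0 // dist_ge0. Qed.

(* [tau] rounds a time down to the last vertex of the chain. *)
Lemma eps_chain_step_curve eps x y c : 0 < eps -> eps_chain eps x y c ->
  exists (f : R -> X) (tau : R -> R),
    (forall s, 0 <= s <= c -> tau s <= s < tau s + eps) /\
    (forall s t, 0 <= s <= c -> 0 <= t <= c -> dist (f s) (f t) <= `|tau s - tau t|) /\
    f 0 = x /\ f c = y /\ tau c = c.
Proof.
move=> eps0; elim=> [|{}y z {}c ch [f [tau [tauP [lf [f0 [fc tauc]]]]]] yz].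
  exists (fun=> x), (fun=> 0); split; last by do !split => // *; rewrite (distxx metricd).
  by move=> s; rewrite add0r => /andP[-> s0]; exact: le_lt_trans s0 eps0.
have c0 := eps_chain_ge0 ch; set d := dist y z in yz *; have d0 : 0 <= d by exact: dist_ge0.
have mP s : 0 <= s -> 0 <= Num.min s c <= c by move=> s0; rewrite le_min s0 c0 ge_min lexx orbT.
exists (fun s => if s < c + d then f (Num.min s c) else z),
       (fun s => if s < c + d then tau (Num.min s c) else c + d).
split; last split; last split; last split.
- move=> s /andP[s0 scd]; case: ltP => scd'; last by apply/andP; split; lra.
  have /andP[t1 t2] := tauP _ (mP _ s0).
  have [sc|cs] := leP s c; first by move: t1 t2; rewrite min_l // => -> ->.
  by move: t1 t2; rewrite min_r ?(ltW cs) // tauc; lra.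
- have H s : 0 <= s -> s < c + d -> dist (f (Num.min s c)) z <= `|tau (Num.min s c) - (c + d)|.
    move=> s0 scd; apply: le_trans (dist_tri metricd y _ _) _; rewrite -/d -{1}fc.
    have cc : 0 <= c <= c by rewrite c0 lexx.
    have := lf _ _ (mP _ s0) cc; rewrite tauc.
    have /andP[t1 _] := tauP _ (mP _ s0); have /andP[_ t2] := mP _ s0.
    by rewrite !ler0_norm; lra.
  move=> s t /andP[s0 scd] /andP[t0 tcd].
  case: (ltP s) => s1; case: (ltP t) => t1.
  + by apply: lf; exact: mP.
  + exact: H.
  + by rewrite (distC metricd) distrC; exact: H.
  + by rewrite (distxx metricd).
- case: ltP => cd; first by rewrite min_l.
  have cd0 : c = 0 /\ d = 0 by split; lra.
  by case: cd0 => cE dE; rewrite -f0 -(dist_eq0 metricd dE) -fc cE.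
- by rewrite ltxx.
- by rewrite ltxx.
Qed.

Variables (mu : {measure set X -> \bar R}) (p : R).
Hypothesis borelmu : completed_borel dist mu.
Hypothesis doublingmu : doubling dist mu.
Hypothesis poincarep : poincare dist mu p.

(** The infimum of lengths of [eps]-chains from [x], truncated at [N], is bounded and 1-Lipschitz at
    scales below [eps]; [poincare_lipschitz] then bounds it by a multiple of the distance
    independent of [eps]. *)
Lemma short_eps_chain : exists C : R, 1 <= C /\
  forall x y (eps : R), 0 < eps -> exists2 c, c <= C * dist x y & eps_chain eps x y c.
Proof.
have [C [C0 HC]] := poincare_lipschitz metricd borelmu doublingmu poincarep.
exists (C + 1); split; first by lra.
move=> x y eps eps0; have [xy0|xy0] := eqVneq (dist x y) 0.
  by exists 0; [rewrite xy0 mulr0|rewrite -(dist_eq0 metricd xy0); exact: eps_chain0].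
have d0 : 0 < dist x y by rewrite lt_def xy0 dist_ge0.
(* The truncation keeps [u] finite where no chain arrives. A near-minimizer at [y] is below
   [(C + 1) * dist x y], hence below [N], so it is the length of a genuine chain. *)
pose N := (C + 2) * dist x y.
have N0 : 0 <= N by rewrite mulr_ge0 ?ltW //; lra.
pose S z := [set N] `|` [set c | eps_chain eps x z c].
have S0 z : S z !=set0 by exists N; left.
have Slb z : lbound (S z) 0 by move=> c [->//|/eps_chain_ge0].
have hS z : has_inf (S z) by split => //; exists 0.
pose u z := inf (S z).
have u0 z : 0 <= u z by apply: lb_le_inf.
have uN z : u z <= N by apply: ge_inf; [exists 0|left].
have ux : u x = 0.
  apply/eqP; rewrite eq_le u0 andbT; apply: ge_inf; first by exists 0.
  by right; exact: eps_chain0.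
have ustep z w : dist z w < eps -> u w <= u z + dist z w.
  move=> zw; rewrite -lerBlDr; apply: lb_le_inf => // c [->|zc].
    by have := uN w; have := dist_ge0 metricd z w; rewrite /=; lra.
  rewrite lerBlDr; apply: ge_inf; first by exists 0.
  by right; exact: eps_chainS.
have ulip z w : dist z w < eps -> `|u z - u w| <= dist z w.
  move=> zw; have := ustep _ _ zw; have := ustep w z; rewrite (distC metricd w) => /(_ zw).
  by rewrite ler_norml; move=> *; apply/andP; split; lra.
have bu : bounded_by N u by move=> z; rewrite ger0_norm.
have := HC u eps N eps0 ulip bu x y; rewrite ux sub0r normrN ger0_norm // => uy.
have [c [cN|cc] clt] := inf_adherent d0 (hS y); last first.
  by exists c => //; move: clt; rewrite -/(u y); lra.
by move: clt; rewrite cN -/(u y) /N; lra.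
Qed.

Hypothesis completed : dcomplete dist.

(** An Arzela-Ascoli argument: step curves along chains of mesh [2^-1 ^+ n] are 1-Lipschitz up to an
    error of that size, and their pointwise ultralimit is 1-Lipschitz. *)
Theorem quasiconvex : exists C : R, 1 <= C /\ forall x y,
  inner dist [set z | dist x z <= C * dist x y] x y (C * dist x y).
Proof.
have [C [C1 HC]] := short_eps_chain; exists C; split => // x y.
set L := C * dist x y; have L0 : 0 <= L by rewrite mulr_ge0 ?dist_ge0 //; lra.
have /choice [c /choice [f /choice [tau H]]] : forall n, exists c f tau,
    (0 <= c <= L) /\ (forall s, 0 <= s <= c -> tau s <= s < tau s + 2^-1 ^+ n) /\
    (forall s t, 0 <= s <= c -> 0 <= t <= c -> dist (f s) (f t) <= `|tau s - tau t|) /\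
    f 0 = x /\ f c = y.
  move=> n; have [c cL ch] := HC x y _ (geo_gt0 n).
  have [f [tau [H1 [H2 [H3 [H4 _]]]]]] := eps_chain_step_curve (geo_gt0 n) ch.
  by exists c, f, tau; rewrite cL (eps_chain_ge0 ch).
(* Each curve waits at its endpoint from time [c n] on, so that all of them reach [y] at the common
   time [L]. *)
pose F n s := f n (Num.min (clamp L s) (c n)).
have mP n s : 0 <= Num.min (clamp L s) (c n) <= c n.
  have [/andP[c0 _] _] := H n.
  by have /andP[s0 _] := clamp_itv s L0; rewrite le_min s0 c0 ge_min lexx orbT.
have lF n s t : dist (F n s) (F n t) <= `|s - t| + 2^-1 ^+ n.
  have [_ [tauP [lf _]]] := H n.
  apply: le_trans (lf _ _ (mP n s) (mP n t)) _.
  have /andP[] := tauP _ (mP n s); have /andP[] := tauP _ (mP n t).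
  have : `|Num.min (clamp L s) (c n) - Num.min (clamp L t) (c n)| <= `|s - t|.
    apply: le_trans (clamp_lip L s t); rewrite /Num.min.
    by do ![case: ifP]; move=> *; rewrite ler_norml; apply/andP; split;
      case: (ler0P (clamp L s - clamp L t)); lra.
  move: (Num.min _ _) (Num.min _ _) => a b; rewrite !ler_norml => /andP[? ?] *.
  by apply/andP; split; lra.
have F0 n : F n 0 = x.
  have [/andP[c0 _] [_ [_ [f0 _]]]] := H n.
  by rewrite /F clamp_id ?lexx // min_l.
have FL n : F n L = y.
  have [/andP[_ cL] [_ [_ [_ fc]]]] := H n.
  by rewrite /F clamp_id ?lexx ?L0 // min_r.
have [U [UU oU]] := ultraFilterLemma (eventually_filter : ProperFilter \oo).
have /choice [g gP] : forall s, exists z, forall e : R, 0 < e ->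
    U [set n | dist (F n s) z < e].
  move=> s; apply: (ultralimit metricd completed UU
    (@tot_bounded_dball _ _ _ _ metricd _ borelmu doublingmu x (`|s| + 2))).
  move=> n; rewrite /dball /= -{1}(F0 n); apply: le_lt_trans (lF _ _ _) _.
  by rewrite sub0r normrN; have := geo_le1 (R := R) n; lra.
have Ugeo (e : R) : 0 < e -> U [set n | (2^-1 : R) ^+ n < e].
  move=> /geo_lt [N Ne]; apply: oU; exists N => // n /= Nn.
  by apply: le_lt_trans Ne; exact: geo_le.
have gE s z : (forall n, F n s = z) -> g s = z.
  move=> Fz; apply: (dist_eq0 metricd); apply/eqP; rewrite eq_le dist_ge0 // andbT.
  apply/ler_addgt0Pr => e e0; rewrite add0r.
  have [n /=] := filter_ex (gP s e e0).
  by rewrite Fz (distC metricd) => /ltW.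
have lg : lip1 dist g.
  move=> s t; apply/ler_addgt0Pr => e e0; have e30 : 0 < e / 3 by lra.
  have UI : U ([set n | dist (F n s) (g s) < e / 3] `&` [set n | dist (F n t) (g t) < e / 3]
      `&` [set n | (2^-1 : R) ^+ n < e / 3]).
    by do 2?[apply: filterI]; [exact: gP|exact: gP|exact: Ugeo].
  have [n [[/= ns nt] ne]] := filter_ex UI.
  have := dist_tri metricd (F n s) (g s) (g t); have := dist_tri metricd (F n t) (F n s) (g t).
  by have := lF n s t; rewrite (distC metricd (g s) (F n s)); lra.
have := @inner_of_segment _ _ _ _ [set z | dist x z <= L] g L L0.
rewrite (gE 0 x F0) (gE L y FL); apply; first by move=> s t _ _; exact: lg.
move=> s /andP[s0 sL] /=; rewrite -(gE 0 x F0); apply: le_trans (lg _ _) _.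
by rewrite sub0r normrN ger0_norm.
Qed.

End Quasiconvexity.

(** * A weight blowing up at the boundary with integrable [p]-th power *)

Section Weight.
Context {R : realType} {dX : measure_display} {X : measurableType dX}.
Variable dist : X -> X -> R.
Hypothesis metricd : is_metric dist.

Lemma borel_efunP (g : X -> \bar R) : borel_efun dist g <->
  measurable_fun setT (g : g_sigma_algebraType (dopen dist) -> \bar R).
Proof.
split=> [bg _ A mA|mg A mA]; first by rewrite setTI; exact: bg.
by have := mg measurableT A mA; rewrite setTI.
Qed.

Lemma measurable_borel_comp_lip1 (g : X -> \bar R) f : borel_efun dist g -> lip1 dist f ->
  measurable_fun setT (g \o f).
Proof.
move=> bg lf; apply: (@measurableT_comp _ _ _ _ (g_sigma_algebraType (dopen dist)) _ g).
  exact/borel_efunP.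
apply: (@measurability _ _ _ (g_sigma_algebraType (dopen dist)) _ _ (dopen dist)) => //.
move=> _ [A oA <-]; rewrite setTI; apply: open_measurable.
exact: lip1_preimage_open oA.
Qed.

Variables (mu : {measure set X -> \bar R}).
Hypothesis borelmu : completed_borel dist mu.
Hypothesis doublingmu : doubling dist mu.

Lemma measurable_borel_efun (D : set X) g : borel_efun dist g -> measurable_fun D g.
Proof.
move=> bg mD A mA; apply: measurableI => //.
by apply: (measurable_borel borelmu); exact: bg.
Qed.

Variable Om : set X.
Hypotheses (openOm : dopen dist Om) (boundedOm : dbounded dist Om) .

Lemma mu_Om_lty : (mu Om < +oo)%E.
Proof.
have [x [r Or]] := boundedOm; pose s := Num.max r 1.
have s0 : 0 < s by rewrite lt_max ltr01 orbT.
apply: (@le_lt_trans _ _ (mu (dball dist x s))); last by rewrite (bmassE doublingmu) // ltry.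
apply: le_measure; rewrite ?inE.
- exact: (measurable_dopen borelmu).
- exact: (measurable_dball metricd borelmu).
- by move=> y /Or; rewrite /dball /= lt_max => ->.
Qed.

Definition near_compl (r : R) := Om `&` [set x | exists2 y, ~ Om y & dist x y < r].

Lemma near_complS r s : r <= s -> near_compl r `<=` near_compl s.
Proof. by move=> rs x [Ox [y Oy xy]]; split => //; exists y => //; exact: lt_le_trans xy rs. Qed.

Lemma dopen_near_compl r : dopen dist (near_compl r).
Proof.
apply: dopenI => // x [y Oy xy]; exists (r - dist x y); first by rewrite subr_gt0.
move=> z; rewrite /dball /= => xz; exists y => //.
by have := dist_tri metricd x z y; rewrite (distC metricd z x); lra.
Qed.

(** The collars of width [2^-1 ^+ n] decrease to the empty set because [Om] is open, and [Om] has
    finite mass, so their masses tend to 0. *)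
Lemma small_near_compl (e : R) : 0 < e ->
  exists r : R, [/\ 0 < r, r <= e & (mu (near_compl r) <= e%:E)%E].
Proof.
move=> e0; pose F n := near_compl (2^-1 ^+ n).
have mF n : measurable (F n) by apply: (measurable_dopen borelmu); exact: dopen_near_compl.
have F0 : \bigcap_n F n = set0.
  rewrite -subset0 => x xF; have [Ox _] := xF 0%N Logic.I.
  have [r r0 rO] := openOm Ox; have [n nr] := geo_lt r0.
  have [_ [y Oy xy]] := xF n Logic.I; apply: Oy; apply: rO.
  exact: lt_trans nr.
have : mu \o F @ \oo --> mu (\bigcap_n F n).
  apply: nonincreasing_cvg_mu => //.
  - apply: le_lt_trans mu_Om_lty; apply: le_measure; rewrite ?inE //.
      exact: (measurable_dopen borelmu).
    by move=> x [].
  - by rewrite F0.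
  - by move=> m n mn; apply/subsetPset; apply: near_complS; exact: geo_le.
rewrite F0 measure0 => cF.
have [N _ NP] : \forall n \near \oo, (mu (F n) < e%:E)%E.
  have oe : nbhs (0%E : \bar R) [set y : \bar R | (y < e%:E)%E].
    by apply: open_nbhs_nbhs; split; [exact: open_ereal_lt_ereal|rewrite /= lte_fin].
  exact: cF oe.
have [M Me] := geo_lt e0; pose n := maxn N M.
exists (2^-1 ^+ n); split; first exact: geo_gt0.
  by apply: le_trans (ltW Me); apply: geo_le; exact: leq_maxr.
by apply: ltW; apply: NP; exact: leq_maxl.
Qed.

Variable p : R.
Hypothesis p_gt0 : 0 < p.

(** [H] counts the collars [A k] containing a point, and the weight is its [p]-th root. The masses
    of the collars are summable, points close to the complement lie in many collars, and locally in
    [Om] only finitely many collars occur. *)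
Lemma boundary_weight : exists h : X -> \bar R,
  [/\ forall x, (0 <= h x)%E, borel_efun dist h,
      (\int[mu]_(x in Om) (h x `^ p) < +oo)%E,
      forall M : R, exists2 s : R, 0 < s & forall x, near_compl s x -> (M%:E <= h x)%E &
      forall x, Om x -> exists2 r : R, 0 < r &
        exists M : R, forall y, dist x y < r -> (h y <= M%:E)%E].
Proof.
have /choice [r rP] : forall k, exists r : R,
    [/\ 0 < r, r <= 1 / (2 ^ k.+1)%:R & (mu (near_compl r) <= (1 / (2 ^ k.+1)%:R)%:E)%E].
  by move=> k; apply: small_near_compl; rewrite divr_gt0 // ltr0n expn_gt0.
pose A k := near_compl (r k).
have oA k : dopen dist (A k) by exact: dopen_near_compl.
have mA k : measurable (A k) by exact: (measurable_dopen borelmu).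
pose H x : \bar R := (\sum_(0 <= k <oo) (\1_(A k) x : R)%:E)%E.
have H0 x : (0 <= H x)%E by apply: nneseries_ge0 => k _ _; rewrite lee_fin.
have bH : borel_efun dist H.
  apply/borel_efunP; apply: (ge0_emeasurable_sum (P := xpredT)) => [k x _ _|k _].
    by rewrite lee_fin.
  apply/measurable_EFinP; apply: measurable_indic.
  by apply: borel_dopen.
have hp x : ((H x `^ p^-1) `^ p)%E = H x.
  by rewrite -poweRrM mulVf ?gt_eqF // poweRe1.
exists (fun x => H x `^ p^-1)%E; split.
- by move=> x; exact: poweR_ge0.
- apply/borel_efunP.
  apply: (@measurableT_comp _ _ _ _ _ _ (fun x => x `^ p^-1)%E) => //.
    exact: measurable_poweR.
  exact/borel_efunP.
- under eq_integral do rewrite hp.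
  have mO : measurable Om by exact: (measurable_dopen borelmu).
  rewrite integral_nneseries //; last first.
    by move=> k; apply/measurable_EFinP; exact: measurable_indic.
  apply: (@le_lt_trans _ _ (1%:E)); last by rewrite ltry.
  apply: (le_trans _ (epsilon_trick0 xpredT (@ler01 R))).
  apply: lee_nneseries => [k _ _|k _]; first by apply: integral_ge0 => x _; rewrite lee_fin.
  rewrite integral_indic //; have [_ _ +] := rP k; apply: le_trans.
  by apply: le_measure; rewrite ?inE; [exact: measurableI|exact: (mA k)|move=> x []].
(* Lying in the first [m] collars gives [H] at least [m], hence a root at least [M]; [s] is below
   their [m] radii. *)
- move=> M; pose m := (Num.truncn (`|M| `^ p)).+1.
  have mM : `|M| `^ p <= m%:R by apply: ltW; exact: truncnS_gt.
  have [s s0 sr] : exists2 s : R, 0 < s & forall k, (k < m)%N -> s <= r k.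
    elim: m {mM} => [|m [s s0 sr]]; first by exists 1.
    exists (Num.min s (r m)); first by rewrite lt_min s0; have [] := rP m.
    move=> k; rewrite ltnS leq_eqVlt => /orP[/eqP ->|km]; first by rewrite ge_min lexx orbT.
    by rewrite ge_min sr.
  exists s => // x xs.
  have mH : (m%:R%:E <= H x)%E.
    apply: le_trans (nneseries_lim_ge m _); last by move=> k _ _; rewrite lee_fin.
    rewrite big_mkord (eq_bigr (fun=> 1%:E)); last first.
      move=> k _; rewrite indicE mem_set //; apply: near_complS xs; exact: sr.
    by rewrite sumEFin sumr_const card_ord.
  apply: (@le_trans _ _ ((`|M| `^ p)%:E `^ p^-1)%E).
    rewrite poweR_EFin -powRrM mulfV ?gt_eqF // powRr1 // lee_fin ler_norm //.
  apply: gt0_ler_poweR; rewrite ?in_itv /= ?leey ?andbT ?H0 ?lee_fin ?powR_ge0 //.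
    by rewrite invr_ge0 ltW.
  by apply: le_trans mH; rewrite lee_fin.
- move=> x Ox; have [t t0 tO] := openOm Ox; exists (t / 2); first by lra.
  (* Collars of index at least [n] are thinner than [t / 2] and miss the ball of radius [t / 2]
     about [x], so [H] is at most [n] there. *)
  have [n nt] : exists n, (2^-1 : R) ^+ n < t / 2 by apply: geo_lt; lra.
  exists (n%:R `^ p^-1) => y xy; rewrite -poweR_EFin.
  apply: gt0_ler_poweR; rewrite ?in_itv /= ?leey ?andbT ?H0 ?lee_fin //.
    by rewrite invr_ge0 ltW.
  rewrite /H (nneseries_split 0 n); last by move=> k _; rewrite lee_fin.
  rewrite eseries0 ?adde0; last first.
    move=> k nk _; rewrite indicE memNset // => -[Oy [z Oz yz]]; apply: Oz; apply: tO.
    rewrite /dball /=; have := dist_tri metricd y x z.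
    suff : r k < t / 2 by lra.
    apply: le_lt_trans nt; have [_ + _] := rP k; move/le_trans; apply.
    rewrite div1r natrX -exprVn; exact: geo_le (leqW nk).
  rewrite add0n big_mkord sumEFin lee_fin; apply: (@le_trans _ _ (\sum_(i < n) 1)).
    by apply: ler_sum => i _; rewrite indicE; case: (_ \in _).
  by rewrite sumr_const card_ord.
Qed.

End Weight.

(** * The weighted distance to a base point, and what a bounded weighted distance implies *)

Section WeightedDistance.
Context {R : realType} {dX : measure_display} {X : measurableType dX}.
Variable dist : X -> X -> R.
Hypothesis metricd : is_metric dist.

(** The joining curve is confined to a prescribed ball, so it stays in [Om] as soon as that ball
    does. *)
Definition locally_quasiconvex (C : R) := forall x (r : R), 0 < r ->
  exists2 del : R, 0 < del & forall y z, dist x y < del -> dist x z < del ->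
    inner dist (dball dist x r) y z (C * dist y z).

Lemma quasiconvex_locally (C : R) : 1 <= C ->
  (forall x y, inner dist [set z | dist x z <= C * dist x y] x y (C * dist x y)) ->
  locally_quasiconvex C.
Proof.
move=> C1 H x r r0; have C20 : 0 < 2 * C + 2 by lra.
(* Points [y], [z] within [del] of [x] are less than [2 * del] apart, so the curve stays within
   [(2 * C + 1) * del] of [x], which is less than [r]. *)
exists (r / (2 * C + 2)); first by rewrite divr_gt0.
set del := r / _; have rE : del * (2 * C + 2) = r by rewrite /del divfK // gt_eqF.
move=> y z xy xz; apply: innerS (H y z) => w /= yw; rewrite /dball /=.
have yz : dist y z < 2 * del.
  by have := dist_tri metricd x y z; rewrite (distC metricd y x); lra.
have Cyz : C * dist y z <= C * (2 * del) by rewrite ler_pM2l ?(ltW yz) //; lra.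
have del0 : 0 < del by rewrite divr_gt0.
by have := dist_tri metricd y x w; lra.
Qed.

Lemma inner_lip1 (U : set X) f (a b : R) : lip1 dist f -> (forall s, U (f s)) ->
  a <= b -> inner dist U (f a) (f b) (b - a).
Proof.
move=> lf Uf ab; split; first by rewrite subr_ge0.
exists (fun s => f (a + s)); split; last by split => //; rewrite addr0 addrC subrK.
by move=> s t; apply: le_trans (lf _ _) _; rewrite opprD addrACA subrr add0r.
Qed.

Variables (C : R) (Om : set X) (h : X -> \bar R) (x0 : X).
Hypotheses (C_ge1 : 1 <= C) (qc : locally_quasiconvex C).
Hypotheses (openOm : dopen dist Om) (connOm : dconnected dist Om) (Omx0 : Om x0).
Hypotheses (h_ge0 : forall x, (0 <= h x)%E) (borel_h : borel_efun dist h).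
Hypothesis h_bnd : forall x, Om x -> exists2 r : R, 0 < r &
        exists M : R, forall y, dist x y < r -> (h y <= M%:E)%E.

(* Working with chains of curves, each traversed in either direction, avoids
   concatenating and reversing line integrals; the strict cost bound makes the
   exit-time argument of [reach_deep] work without closing up the exit set. *)
Inductive reach : X -> R -> Prop :=
| reach0 : reach x0 0
| reachS x y c f l b : reach x c -> lip1 dist f -> (forall s, Om (f s)) -> 0 <= l ->
    (f 0 = x /\ f l = y) \/ (f 0 = y /\ f l = x) ->
    (line_int h f l < b%:E)%E -> reach y (c + b).

Lemma line_int_ge0 f l : (0 <= line_int h f l)%E.
Proof. exact: integral_ge0. Qed.

Lemma measurable_h_lip1 D f : lip1 dist f -> measurable_fun D (h \o f).
Proof. by move=> lf; apply: measurable_funTS; exact: (measurable_borel_comp_lip1 borel_h lf). Qed.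

Lemma itv_measure (a l : R) : a <= l ->
  @lebesgue_measure R (`[a, l]%classic : set R) = (l - a)%:E.
Proof.
rewrite lebesgue_measure_itv /= lte_fin le_eqVlt => /orP[/eqP ->|->]; last by rewrite EFinB.
by rewrite ltxx subrr.
Qed.

Lemma line_int_le (M l : R) f : lip1 dist f -> 0 <= l -> (forall s, (h (f s) <= M%:E)%E) ->
  (line_int h f l <= (M * l)%:E)%E.
Proof.
move=> lf l0 hM; rewrite /line_int.
apply: (@le_trans _ _ (\int[lebesgue_measure]_(s in `[0%R, l]) (cst M%:E s))%E).
  by apply: ge0_le_integral => //; exact: measurable_h_lip1.
by rewrite integral_cst //= itv_measure // -EFinM subr0.
Qed.

Lemma line_int_ge (M l a d : R) f : lip1 dist f -> 0 <= M -> 0 <= a -> 0 <= d -> a + d <= l ->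
  (forall s, a <= s <= a + d -> (M%:E <= h (f s))%E) -> ((M * d)%:E <= line_int h f l)%E.
Proof.
move=> lf M0 a0 d0 adl hM.
have ad : a <= a + d by lra.
have -> : (M * d)%:E = (\int[lebesgue_measure]_(s in `[a, (a + d)%R]) (cst M%:E s))%E.
  by rewrite integral_cst //= itv_measure // -EFinM addrAC subrr add0r.
apply: (@le_trans _ _ (\int[lebesgue_measure]_(s in `[a, (a + d)%R]) (h (f s)))%E).
  apply: ge0_le_integral => //; exact: measurable_h_lip1.
apply: ge0_subset_integral => //; first exact: measurable_h_lip1.
by move=> s /=; rewrite !in_itv /= => /andP[? ?]; apply/andP; split; lra.
Qed.

Lemma reach_ge0 x c : reach x c -> 0 <= c.
Proof.
elim=> // y z {}c f l b _ c0 _ _ _ _ /(le_lt_trans (line_int_ge0 _ _)).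
by rewrite lte_fin => b0; rewrite addr_ge0 // ltW.
Qed.

Lemma reach_mem x c : reach x c -> Om x.
Proof. by elim=> // y z {}c f l b _ _ _ Of _ [[_ <-]|[<- _]]. Qed.

(** Near [x] the weight is bounded and quasiconvexity provides short curves in [Om]. The extra [e]
    pays for the strict inequality in [reachS]. *)
Lemma reach_local x : Om x -> exists2 del : R, 0 < del & exists2 K : R, 0 <= K &
  forall y z, dist x y < del -> dist x z < del -> Om y /\
    forall c e, 0 < e -> reach y c -> reach z (c + (K * dist y z + e)).
Proof.
have C0 : 0 <= C by exact: le_trans C_ge1.
move=> Ox; have [r1 r10 [M HM]] := h_bnd Ox; have [r2 r20 rO] := openOm Ox.
pose r := Num.min r1 r2; have r0 : 0 < r by rewrite lt_min r10.
have [del del0 H] := qc x r0; exists del => //.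
pose N := Num.max M 0; have N0 : 0 <= N by rewrite le_max lexx orbT.
exists (N * C); first by rewrite mulr_ge0.
move=> y z xy xz; have yz := H _ _ xy xz.
have sub w : dball dist x r w -> dist x w < r1 /\ Om w.
  by rewrite /dball /= lt_min => /andP[? ?]; split => //; exact: rO.
split; first by have [/sub []] := inner_mem yz.
move=> c e e0 yc; have [l0 [f [lf [Uf [f0 fl]]]]] := yz.
apply: (reachS yc lf _ l0 (or_introl (conj f0 fl))).
  by move=> s; have [] := sub _ (Uf s).
apply: (@le_lt_trans _ _ (N * (C * dist y z))%:E).
  apply: line_int_le => // s; have [/HM + _] := sub _ (Uf s); move/le_trans; apply.
  by rewrite lee_fin le_max lexx.
by rewrite lte_fin; lra.
Qed.

(** By [reach_local], the reachable points and the remaining points of [Om] both form open sets;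
    [Om] is connected. *)
Lemma reach_total x : Om x -> exists c, reach x c.
Proof.
pose U := [set y | exists c, reach y c]; pose V := Om `\` U.
have oU : dopen dist U.
  move=> y [c yc]; have [del del0 [K K0 H]] := reach_local (reach_mem yc).
  exists del => // z yz; have yy : dist y y < del by rewrite distxx.
  by have [_ /(_ c 1 ltr01 yc)] := H y z yy yz; exists (c + (K * dist y z + 1)).
have oV : dopen dist V.
  move=> y [Oy nUy]; have [del del0 [K K0 H]] := reach_local Oy.
  exists del => // z yz; have yy : dist y y < del by rewrite distxx.
  have [Oz Hz] := H z y yz yy; split => // -[c zc]; apply: nUy.
  by have := Hz c 1 ltr01 zc; exists (c + (K * dist z y + 1)).
move=> Ox; apply: contrapT => nx.
have [||H|H] := connOm oU oV.
- by move=> y Oy; have [|] := pselect (U y); [left|right].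
- by rewrite -subset0 => y [[_ Uy] [_]].
- by suff : set0 x0 by []; rewrite -H; split => //; exists 0; exact: reach0.
- by suff : set0 x by []; rewrite -H; split => //; split.
Qed.

Definition wdist x := inf [set c | reach x c].

Lemma wdist_has_inf x : Om x -> has_inf [set c | reach x c].
Proof.
move=> /reach_total [c xc]; split; first by exists c.
by exists 0 => b /reach_ge0.
Qed.

Lemma wdist_le x c : reach x c -> wdist x <= c.
Proof. by move=> xc; apply: ge_inf => //; exists 0 => b /reach_ge0. Qed.

Lemma wdist_ge0 x : Om x -> 0 <= wdist x.
Proof. by move=> /wdist_has_inf [? _]; apply: lb_le_inf => // b /reach_ge0. Qed.

Lemma wdist_lt x (c : R) : Om x -> wdist x < c -> exists2 b, reach x b & b < c.
Proof.
move=> Ox xc; have e0 : 0 < c - wdist x by rewrite subr_gt0.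
have [b xb bc] := inf_adherent e0 (wdist_has_inf Ox).
by exists b => //; move: bc; rewrite -/(wdist x); lra.
Qed.

Lemma wdist_step x y (k : R) : Om x ->
  (forall c e, 0 < e -> reach x c -> reach y (c + (k + e))) -> wdist y <= wdist x + k.
Proof.
move=> Ox H; apply/ler_addgt0Pr => e e0; have e20 : 0 < e / 2 by lra.
have [c xc cx] := inf_adherent e20 (wdist_has_inf Ox).
by have := wdist_le (H _ _ e20 xc); move: cx; rewrite -/(wdist x); lra.
Qed.

Lemma wdist_continuous x : Om x -> forall e : R, 0 < e -> exists2 del : R, 0 < del &
  forall y, dist x y < del -> wdist x - e <= wdist y.
Proof.
move=> Ox e e0; have [del del0 [K K0 H]] := reach_local Ox.
exists (Num.min del (e / (K + 1))).
  by rewrite lt_min del0 divr_gt0 //; lra.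
move=> y; rewrite lt_min ltr_pdivlMr; last by lra.
move=> /andP[xy xe]; have xx : dist x x < del by rewrite distxx.
have [Oy Hy] := H y x xy xx; have := wdist_step Oy Hy.
have := dist_ge0 metricd x y; rewrite (distC metricd y x); lra.
Qed.

(** A curve of finite weighted length prolongs any chain arriving at either of its ends. This is
    what makes the weight an upper gradient of [wdist]. *)
Lemma wdist_curve f (l : R) : lip1 dist f -> (forall s, Om (f s)) -> 0 <= l ->
  (`|wdist (f 0) - wdist (f l)|%:E <= line_int h f l)%E.
Proof.
move=> lf Of l0; have := line_int_ge0 f l.
case E : (line_int h f l) => [k| |] //; last by move=> _; rewrite leey.
rewrite !lee_fin => k0.
have H1 : wdist (f l) <= wdist (f 0) + k.
  apply: wdist_step => // c e e0 xc; apply: (reachS xc lf Of l0); first by left.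
  by rewrite E lte_fin; lra.
have H2 : wdist (f 0) <= wdist (f l) + k.
  apply: wdist_step => // c e e0 xc; apply: (reachS xc lf Of l0); first by right.
  by rewrite E lte_fin; lra.
by rewrite ler_norml; apply/andP; split; lra.
Qed.

(** Inside the collar length costs at least [M] per unit, so going back from [x] along the chain one
    leaves the collar within length [c / M]. *)
Lemma reach_deep (M s : R) x c : 0 < M -> (forall y, near_compl dist Om s y -> (M%:E <= h y)%E) ->
  ~ near_compl dist Om s x0 -> reach x c ->
  exists y, [/\ Om y, ~ near_compl dist Om s y & inner dist Om y x (c / M)].
Proof.
move=> M0 HM nx0; elim=> [|{}x y {}c f l b xc [z [Oz nz zx]] lf Of l0 fxy fb].
  by exists x0; split => //; apply: inner_refl => //; rewrite mul0r.
have c0 := reach_ge0 xc.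
have b0 : 0 < b by rewrite -lte_fin; apply: le_lt_trans fb; exact: line_int_ge0.
have bM0 : 0 < b / M by rewrite divr_gt0.
have bcM : b / M <= (c + b) / M by rewrite ler_pM2r ?invr_gt0 //; lra.
(* A last curve of length at most [b / M] is simply appended to the path from the earlier deep
   point; a longer one contains a deep point close to its own end. *)
have [lbM|lbM] := leP l (b / M).
  exists z; split => //; rewrite mulrDl; apply: (inner_trans metricd zx).
  apply: (inner_le metricd lbM); have := inner_lip1 lf Of l0; rewrite subr0.
  by case: fxy => -[-> ->] //; exact: inner_sym.
(* A time window of length [b / M] spent entirely in the collar would already cost [b]. It is
   applied to the last or the first window, according to the direction of travel. *)
have ex a : 0 <= a -> a + b / M <= l ->
    exists2 t, a <= t <= a + b / M & ~ near_compl dist Om s (f t).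
  move=> a0 al; apply: contrapT => H.
  have : ((M * (b / M))%:E <= line_int h f l)%E.
    apply: (line_int_ge lf (ltW M0) a0 (ltW bM0) al) => t ht.
    by apply: HM; apply: contrapT => nt; apply: H; exists t.
  by rewrite (mulrC M) divfK ?gt_eqF // => /le_lt_trans /(_ fb); rewrite ltxx.
case: fxy => -[f0 fl].
  have [||t /andP[t1 t2] nt] := ex (l - b / M); [by lra|by lra|].
  have tl : t <= l by lra.
  exists (f t); split => //; rewrite -fl; apply: (inner_le metricd _ (inner_lip1 lf Of tl)).
  by lra.
have [||t /andP[t1 t2] nt] := ex 0; [by lra|by lra|].
exists (f t); split => //; rewrite -f0; apply: inner_sym.
by apply: (inner_le metricd _ (inner_lip1 lf Of t1)); lra.
Qed.

End WeightedDistance.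

(** * Joining points of bounded weighted distance, and elementary facts about chains of acceptable
    sets *)

Section PrimeEnds.
Context {R : realType} {dX : measure_display} {X : measurableType dX}.
Variable dist : X -> X -> R.
Hypothesis metricd : is_metric dist.
Variables (Om : set X) (C : R).
Hypotheses (openOm : dopen dist Om) (C_ge1 : 1 <= C) (qc : locally_quasiconvex dist C).

(** The deep points [y n] accumulate at a point [z] of [Om], around which they are joined by short
    curves; hence so are the corresponding [x n]. A single ultrafilter handles all scales [j]
    together. *)
Lemma inner_subsequence (x : nat -> X) : dcomplete dist -> tot_bounded dist Om ->
  (forall e : R, 0 < e -> exists2 s : R, 0 < s & forall n, exists y,
     [/\ Om y, ~ near_compl dist Om s y & inner dist Om y (x n) e]) ->
  exists m : nat -> nat, (forall j, (j <= m j)%N) /\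
    forall j, inner dist Om (x (m j)) (x (m j.+1)) (2^-1 ^+ j.+1).
Proof.
move=> completed tbO H.
have [U [UU oU]] := ultraFilterLemma (eventually_filter : ProperFilter \oo).
have /choice [S SP] : forall j, exists S : set nat, U S /\
    forall n m, S n -> S m -> inner dist Om (x n) (x m) (2^-1 ^+ j.+1).
  (* Three legs of length [e], from [x n] to [y n] to [y m] to [x m], stay below [2^-1 ^+ j.+1]. *)
  move=> j; have e0 := geo_gt0 (R := R) j.+3; set e := _ ^+ _ in e0.
  have [s s0 /choice [y yP]] := H _ e0.
  have Oy n : Om (y n) by have [] := yP n.
  have [z zP] := ultralimit metricd completed UU tbO Oy.
  (* Were [z] outside [Om], some [y n] within [s] of it would lie in the collar. *)
  have Oz : Om z.
    apply: contrapT => nz; have [n /= ns] := filter_ex (zP _ s0).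
    by have [_ ny _] := yP n; apply: ny; split => //; exists z.
  have [r r0 rO] := openOm Oz; have [del del0 dP] := qc z r0.
  have C0 : 0 < C by exact: lt_le_trans C_ge1.
  have eC0 : 0 < e / (2 * C) by rewrite divr_gt0 // mulr_gt0.
  have md0 : 0 < Num.min del (e / (2 * C)) by rewrite lt_min del0.
  exists [set n | dist (y n) z < Num.min del (e / (2 * C))]; split; first exact: zP.
  move=> n m; rewrite /= !lt_min => /andP[nd ne] /andP[md me].
  rewrite (distC metricd) in nd; rewrite (distC metricd) in md.
  have ynm : inner dist Om (y n) (y m) e.
    apply: (inner_le metricd _ (innerS rO (dP _ _ nd md))).
    rewrite mulrC -ler_pdivlMr //.
    have := dist_tri metricd z (y n) (y m); rewrite (distC metricd z).
    have -> : e / C = e / (2 * C) + e / (2 * C) by field; rewrite gt_eqF.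
    lra.
  have [_ _ xn] := yP n; have [_ _ xm] := yP m.
  apply: (inner_le metricd _ (inner_trans metricd (inner_trans metricd (inner_sym xn) ynm) xm)).
  by rewrite /e !exprS; have := geo_gt0 (R := R) j; lra.
(* Membership in all earlier [S i] is demanded so that [m j] and [m j.+1] both lie in [S j]. *)
have UI j : U [set n | (j <= n)%N /\ forall i, (i <= j)%N -> S i n].
  have Uj : U [set n | (j <= n)%N] by apply: oU; exists j.
  have US : U [set n | forall i, (i <= j)%N -> S i n].
    elim: j {Uj} => [|j IH].
      have [U0 _] := SP 0%N; apply: filterS U0 => n Sn i.
      by rewrite leqn0 => /eqP ->.
    have [Uj _] := SP j.+1; apply: filterS2 Uj IH => n Sn Hn i.
    by rewrite leq_eqVlt => /orP[/eqP -> //|]; rewrite ltnS; exact: Hn.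
  exact: filterI Uj US.
have /choice [m mP] : forall j, exists n, (j <= n)%N /\ forall i, (i <= j)%N -> S i n.
  by move=> j; exact: filter_ex (UI j).
exists m; split; first by move=> j; have [] := mP j.
move=> j; have [_ Sj] := SP j; have [_ m1] := mP j; have [_ m2] := mP j.+1.
by apply: Sj; [exact: m1|exact: m2].
Qed.

Lemma ereal_gt0_real (a : \bar R) : (0 < a)%E -> exists2 e : R, 0 < e & (e%:E <= a)%E.
Proof.
case: a => [r| |] //; first by rewrite lte_fin => r0; exists r.
by move=> _; exists 1 => //; rewrite leey.
Qed.

Lemma chain_le (E : nat -> set X) i j : chain dist Om E -> (i <= j)%N -> E j `<=` E i.
Proof.
move=> [_ [EE _]] /subnK <-; elim: (j - i)%N => [//|k IH]; rewrite addSn.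
exact: subset_trans (EE _) IH.
Qed.

Lemma chain_sub (E : nat -> set X) k : chain dist Om E -> E k `<=` Om.
Proof. by move=> [/(_ k) [_ [+ _]] _]. Qed.


(** A point of [E k.+1] outside the interior of [E k] would lie on both boundaries, and the
    one-point continuum there would make the Mazurkiewicz gap zero. *)
Lemma chain_interior (E : nat -> set X) k : chain dist Om E -> E k.+1 `<=` dinterior dist (E k).
Proof.
move=> cE x Ex; apply: contrapT => nI.
have [e e0] := ereal_gt0_real (cE.2.2.1 k); apply/negP; rewrite -ltNge.
apply: (@le_lt_trans _ _ 0%:E); last by rewrite lte_fin.
have Ox := chain_sub cE Ex; have EE : E k.+1 `<=` E k by apply: chain_le.
apply: ge_ereal_inf; exists (dM dist Om x x).
  exists x, x; split; last split => //.
    split => //; split; first exact: sub_dclosure.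
    by move=> [r r0 rE]; apply: nI; exists r => // y /rE /EE.
  by split => //; split => //; apply: sub_dclosure => //; exact: EE.
apply: ge_ereal_inf; exists (diam dist [set x]); last first.
  by apply: diam_le => y z -> ->; rewrite (distxx metricd).
exists [set x]; split; last split; last by do !split => //; move=> _ ->.
  have -> : [set x] = (fun=> x : X) @` `[0 : R, 1].
    rewrite predeqE => y; split => [->|[]//]; by exists 0 => //=; rewrite in_itv /= lexx ler01.
  by apply: (@dcompact_lip1_image _ _ _ dist (fun=> x)) => s t; rewrite (distxx metricd).
move=> U V _ _ xUV UV0; have [Ux|Vx] := xUV x erefl.
  by right; rewrite -UV0; rewrite predeqE => y; split => [[-> ?]|[[-> ?] ?]].
by left; rewrite -UV0; rewrite predeqE => y; split => [[-> ?]|[[-> ?] ?]].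
Qed.

Lemma dconnected_star (F : set X) b : F b ->
  (forall y, F y -> exists K, [/\ dconnected dist K, K b, K y & K `<=` F]) -> dconnected dist F.
Proof.
move=> Fb H U V oU oV FUV FUV0.
have one P Q : dopen dist P -> dopen dist Q -> F `<=` P `|` Q -> F `&` P `&` Q = set0 ->
    P b -> F `&` Q = set0.
  move=> oP oQ FPQ FPQ0 Pb; rewrite -subset0 => y [Fy Qy].
  have [K [cK Kb Ky KF]] := H y Fy.
  have [||K0|K0] := cK P Q oP oQ.
  - exact: subset_trans KF FPQ.
  - by rewrite -subset0 -FPQ0 => w [[/KF ? ?] ?].
  - by suff : set0 b by []; rewrite -K0.
  - by rewrite -K0.
have [Ub|Vb] := FUV b Fb; [right; exact: (one U V)|left; apply: (one V U) => //].
  by rewrite setUC.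
by rewrite setIAC.
Qed.

Lemma inner_segment (U : set X) gam (a b : R) :
  (forall s t, 0 <= s <= 1 -> 0 <= t <= 1 -> dist (gam s) (gam t) <= `|s - t|) ->
  0 <= a -> a <= b -> b <= 1 -> (forall s, a <= s <= b -> U (gam s)) ->
  inner dist U (gam a) (gam b) (b - a).
Proof.
move=> lg a0 ab b1 Ug; have ba0 : 0 <= b - a by rewrite subr_ge0.
have := @inner_of_segment _ _ _ dist U (fun s => gam (a + s)) (b - a) ba0.
rewrite addr0 (addrC a) subrK; apply.
  move=> s t /andP[s0 s1] /andP[t0 t1]; apply: le_trans (lg _ _ _ _) _; [by lra|by lra|].
  by rewrite opprD addrACA subrr add0r.
by move=> s /andP[s0 s1]; apply: Ug; apply/andP; split; lra.
Qed.

(** * Ends followed by a rectifiable curve, and the components of [Om] near its endpoint *)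

Section EndCurve.
Variables (E : nat -> set X) (gam : R -> X).
Hypothesis chainE : chain dist Om E.
Hypothesis lip_gam : forall s t, 0 <= s <= 1 -> 0 <= t <= 1 -> dist (gam s) (gam t) <= `|s - t|.
Hypothesis Om_gam : forall s, 0 <= s < 1 -> Om (gam s).
Hypothesis gam_E : forall j, E j (gam (1 - 2^-1 ^+ j)).

(** A late piece of the curve starts in [E k.+1] and has diameter below the Mazurkiewicz gap, so it
    cannot leave [E k]. *)
Lemma curve_tail k : exists t, 0 < t < 1 /\ forall s, t < s < 1 -> E k (gam s).
Proof.
have [e e0 eP] := ereal_gt0_real (chainE.2.2.1 k).
have [j0 j0e] := geo_lt e0; pose j := maxn k.+1 j0.
have je : (2^-1 : R) ^+ j < e by apply: le_lt_trans j0e; apply: geo_le; exact: leq_maxr.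
have gj0 := geo_gt0 (R := R) j.
have gj1 : (2^-1 : R) ^+ j < 1.
  have : (2^-1 : R) ^+ j <= 2^-1 ^+ 1 by apply: geo_le; apply: leq_trans (leq_maxl _ _).
  by rewrite expr1; lra.
exists (1 - 2^-1 ^+ j); split; first by apply/andP; split; lra.
move=> s /andP[ts s1]; apply: contrapT => nEs.
set t := 1 - _ in ts.
pose U := [set y | exists2 r, t <= r <= s & y = gam r].
have UO : U `<=` Om.
  by move=> _ [r /andP[r1 r2] ->]; apply: Om_gam; apply/andP; split; rewrite /t in r1; lra.
have inn : inner dist U (gam t) (gam s) (s - t).
  by apply: inner_segment => //; [rewrite /t; lra|exact: ltW|exact: ltW|move=> r hr; exists r].
have Et : E k.+1 (gam t) by apply: (chain_le chainE (leq_maxl k.+1 j0)); exact: gam_E.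
have H : (distM dist Om (Om `&` dboundary dist (E k.+1))
    (Om `&` dboundary dist (E k)) <= (2^-1 ^+ j)%:E)%E.
  apply: (@inner_crossing _ _ _ _ metricd Om _ _ U _ _ _ _
    (chain_le chainE (leqnSn k)) UO inn Et nEs).
  move=> u v [a /andP[a1 a2] ->] [b /andP[b1 b2] ->].
  apply: le_trans (lip_gam _ _) _; rewrite /t in a1 b1; try by apply/andP; split; lra.
  by rewrite ler_norml; apply/andP; split; lra.
by have := le_trans eP H; rewrite lee_fin; lra.
Qed.

Let z := gam 1.

Lemma gam_near s : 0 <= s <= 1 -> dist z (gam s) <= 1 - s.
Proof.
move=> hs; rewrite (distC metricd); apply: le_trans (lip_gam hs _) _; first by rewrite ler01 lexx.
by case/andP: hs => s0 s1; rewrite distrC ger0_norm ?subr_ge0.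
Qed.

Lemma gam_end_impression : impression dist E z.
Proof.
move=> k _ r r0; have [t [/andP[t0 t1] tP]] := curve_tail k.
pose s := Num.max ((1 + t) / 2) (1 - r / 2).
have s1 : s < 1 by rewrite gt_max; apply/andP; split; lra.
have ts : t < s by rewrite lt_max; apply/orP; left; lra.
have rs : 1 - r / 2 <= s by rewrite le_max lexx orbT.
exists (gam s); split; first by apply: tP; rewrite ts.
apply: le_lt_trans (gam_near _) _; first by apply/andP; split; lra.
by lra.
Qed.

Lemma gam_end_boundary : dboundary dist Om z.
Proof. exact: (chainE.2.2.2 _ gam_end_impression). Qed.

Lemma gam_end_notin : ~ Om z.
Proof. by move=> Oz; have [_] := gam_end_boundary; apply; exact: openOm. Qed.

Variable x0 : X.
Hypothesis Omx0 : Om x0.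

(** The bound by [dist x0 z] keeps [x0] out of the balls, which makes the [F l] proper subsets of
    [Om]; the bound by 1 keeps the times [tau l] positive. [F l] is the path component of [V l]
    containing the tail of the curve after [tau l]. *)
Let rho0 := Num.min 1 (dist x0 z).
Let rho (l : nat) : R := rho0 * 2^-1 ^+ l.
Let tau (l : nat) : R := 1 - rho l / 2.
Let V (l : nat) := Om `&` dball dist z (rho l).
Let F (l : nat) := [set y | exists r, inner dist (V l) (gam (tau l)) y r].

Lemma rho0_gt0 : 0 < rho0.
Proof.
rewrite lt_min ltr01 /= lt_def dist_ge0 // andbT; apply/negP => /eqP /(dist_eq0 metricd) xz.
by apply: gam_end_notin; rewrite -xz.
Qed.

Lemma rho_gt0 l : 0 < rho l.
Proof. by rewrite mulr_gt0 ?geo_gt0 ?rho0_gt0. Qed.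

Lemma rho_le i j : (i <= j)%N -> rho j <= rho i.
Proof. by move=> ij; rewrite ler_pM2l ?rho0_gt0 //; exact: geo_le. Qed.

Lemma rhoS l : rho l.+1 = rho l / 2.
Proof. by rewrite /rho exprS mulrCA mulrC. Qed.

Lemma rho_le1 l : rho l <= 1.
Proof.
apply: le_trans (rho_le (leq0n l)) _; rewrite /rho expr0 mulr1 /rho0.
by rewrite ge_min lexx.
Qed.

Lemma rho_lt (e : R) : 0 < e -> exists l, rho l < e.
Proof.
move=> e0; have [l le] := geo_lt e0; exists l; apply: le_lt_trans le.
rewrite /rho ler_piMl ?(ltW (geo_gt0 _)) // /rho0.
by rewrite ge_min lexx.
Qed.

Lemma gam_ball l s : tau l <= s < 1 -> V l (gam s).
Proof.
move=> /andP[ts s1]; have r0 := rho_gt0 l; have r1 := rho_le1 l.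
rewrite /tau in ts; split; first by apply: Om_gam; apply/andP; split; lra.
rewrite /dball /=; apply: le_lt_trans (gam_near _) _; last by lra.
by apply/andP; split; lra.
Qed.

Lemma gam_component l s : tau l <= s < 1 -> F l (gam s).
Proof.
move=> /andP[ts s1]; have r0 := rho_gt0 l; have r1 := rho_le1 l.
exists (s - tau l); apply: inner_segment => //; [by rewrite /tau; lra|exact: ltW|].
by move=> r /andP[tr rs]; apply: gam_ball; rewrite tr /=; exact: le_lt_trans s1.
Qed.

Lemma tau_lt1 l : tau l < 1.
Proof. by have := rho_gt0 l; rewrite /tau; lra. Qed.

Lemma tau_le i j : (i <= j)%N -> tau i <= tau j.
Proof. by move=> /rho_le; rewrite /tau; lra. Qed.

Lemma component_sub l : F l `<=` V l.
Proof. by move=> y [r yr]; have [] := inner_mem yr. Qed.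

Lemma component_connected l : dconnected dist (F l).
Proof.
apply: (@dconnected_star _ (gam (tau l))); first by apply: gam_component; rewrite lexx tau_lt1.
move=> y [r [r0 [f [lf [Vf [f0 fr]]]]]]; exists (f @` `[0, r]); split.
- by apply: dconnected_lip1_image => //; exact: interval_is_interval.
- by exists 0 => //=; rewrite in_itv /= lexx r0.
- by exists r => //=; rewrite in_itv /= lexx r0.
- move=> _ [s /= + <-]; rewrite in_itv /= => /andP[s0 _]; exists s.
  by have := inner_lip1 lf Vf s0; rewrite f0 subr0.
Qed.

Lemma component_nested l : F l.+1 `<=` F l.
Proof.
have VV : V l.+1 `<=` V l.
  by move=> y [Oy yr]; split => //; apply: lt_le_trans yr (rho_le (leqnSn l)).
move=> y [r ry]; have [r' br'] : F l (gam (tau l.+1)).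
  by apply: gam_component; rewrite tau_le // tau_lt1.
by exists (r' + r); apply: (inner_trans metricd br'); exact: innerS ry.
Qed.

(** Around a point of the open set [V l], local quasiconvexity joins nearby points inside [V l]; a
    path component whose closure contains that point thus contains a neighbourhood of it. *)
Lemma component_boundary l x : Om x -> dboundary dist (F l) x -> rho l <= dist z x.
Proof.
move=> Ox [cx nI]; rewrite leNgt; apply/negP => xr; apply: nI.
have oV : dopen dist (V l) by apply: dopenI => //; exact: dopen_dball.
have [r r0 rV] := oV x (conj Ox xr); have [del del0 dP] := qc x r0.
exists del => // w xw; have [y [[t Fy] xy]] := cx _ del0.
exists (t + C * dist y w); apply: (inner_trans metricd Fy).
by apply: innerS rV _; exact: dP.
Qed.

Lemma component_closure l x : dclosure dist (F l) x -> dist z x <= rho l.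
Proof.
move=> cx; apply/ler_addgt0Pr => e e0; have [y [/component_sub [_ yr] xy]] := cx e e0.
by have := dist_tri metricd y z x; move: yr; rewrite /dball /= (distC metricd y x); lra.
Qed.

Lemma component_impression x : impression dist F x -> x = z.
Proof.
move=> Ix; apply: esym; apply: (dist_eq0 metricd); apply/eqP; rewrite eq_le dist_ge0 // andbT.
apply/ler_addgt0Pr => e /rho_lt [l le]; rewrite add0r.
by apply: le_trans (component_closure (Ix l Logic.I)) (ltW le).
Qed.

Lemma chain_component : chain dist Om F.
Proof.
split; last split; last split.
- move=> l; split; first exact: component_connected.
  split; first by move=> y /component_sub [].
  split.
    move=> FO; have : F l x0 by rewrite FO.
    move=> /component_sub [_]; rewrite /dball /= (distC metricd) ltNge.
    rewrite (le_trans (rho_le (leq0n l))) // /rho expr0 mulr1 /rho0.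
    by rewrite ge_min lexx orbT.
  exists z; split; last exact: gam_end_boundary.
  move=> r r0; pose s := Num.max (tau l) (1 - r / 2).
  have ts : tau l <= s by rewrite le_max lexx.
  have rs : 1 - r / 2 <= s by rewrite le_max lexx orbT.
  have s1 : s < 1 by rewrite gt_max tau_lt1 /=; lra.
  exists (gam s); split; first by apply: gam_component; rewrite ts.
  apply: le_lt_trans (gam_near _) _; last by lra.
  by have := rho_le1 l; move: ts; rewrite /tau => ? ?; apply/andP; split; lra.
- exact: component_nested.
(* Within [Om], the boundary of [F l.+1] is at distance at most [rho l.+1] from [z] and that of
   [F l] at least [rho l]; the Mazurkiewicz distance dominates [dist]. *)
- move=> l; apply: (@lt_le_trans _ _ (rho l - rho l.+1)%:E).
    by rewrite lte_fin rhoS; have := rho_gt0 l; lra.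
  apply: le_ereal_inf_tmp => _ [x [y [[Ox bx] [[Oy by_] ->]]]].
  apply: le_trans (dist_le_dM _ _ _ _); rewrite lee_fin.
  have := component_closure bx.1; have := component_boundary Oy by_.
  have := dist_tri metricd x z y; lra.
- by move=> x /component_impression ->; exact: gam_end_boundary.
Qed.

(** For large [l] the diameter of [V l] is below the gap between [E k.+1] and [E k], so curves in
    [V l] issuing from [gam (tau l)], a point of [E k.+1], remain in [E k]. *)
Lemma component_divides : divides F E.
Proof.
move=> k; have [e e0 eP] := ereal_gt0_real (chainE.2.2.1 k).
have [t [/andP[t0 t1] tP]] := curve_tail k.+1.
have [l0 l0e] : exists l, rho l < e / 4 by apply: rho_lt; lra.
have [l1 l1e] : exists l, rho l < 1 - t by apply: rho_lt; lra.
pose l := maxn l0 l1; exists l => y [r inn]; apply: contrapT => nEy.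
have le0 := rho_le (leq_maxl l0 l1); have le1 := rho_le (leq_maxr l0 l1).
have r0 := rho_gt0 l.
have Et : E k.+1 (gam (tau l)).
  by apply: tP; rewrite tau_lt1 andbT /tau -/l in le1 *; lra.
have VO : V l `<=` Om by move=> ? [].
have H : (distM dist Om (Om `&` dboundary dist (E k.+1))
    (Om `&` dboundary dist (E k)) <= (e / 2)%:E)%E.
  apply: (@inner_crossing _ _ _ _ metricd Om _ _ (V l) _ _ _ _
    (chain_le chainE (leqnSn k)) VO inn Et nEy).
  move=> u v [_ zu] [_ zv]; move: zu zv; rewrite /dball /= => zu zv.
  by have := dist_tri metricd z u v; rewrite (distC metricd u z) -/l in le0 *; lra.
by have := le_trans eP H; rewrite lee_fin; lra.
Qed.

Lemma gam_rect_curve01 : rect_curve01 dist gam.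
Proof.
split.
  move=> s hs e e0; exists e => // t ht st; apply: le_lt_trans st.
  by rewrite distrC; exact: lip_gam.
apply: (@le_lt_trans _ _ 1%:E); last by rewrite ltry.
apply: ge_ereal_sup => _ [n [t [t0 [tn [tle ->]]]]]; rewrite lee_fin.
have mono i j : (i <= j)%N -> (j <= n)%N -> t i <= t j.
  move=> /subnK <-; elim: (j - i)%N => [//|k IH]; rewrite addSn => kn.
  by apply: le_trans (IH (ltnW kn)) _; exact: tle.
have t01 i : (i <= n)%N -> 0 <= t i <= 1.
  by move=> ni; rewrite -t0 -tn; apply/andP; split; exact: mono.
apply: (@le_trans _ _ (\sum_(i < n) (t i.+1 - t i))).
  apply: ler_sum => i _; apply: le_trans (lip_gam (t01 _ (ltnW (ltn_ord i))) (t01 _ (ltn_ord i))) _.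
  by rewrite distrC ger0_norm // subr_ge0 tle.
by rewrite -(big_mkord xpredT (fun i => t i.+1 - t i)) telescope_sumr // t0 tn subr0.
Qed.

(* The components [F l] of [Om] cut down to shrinking balls around the endpoint
   form a chain dividing [E]; primality makes [E] divide it, which forces the
   impression of [E] down to that endpoint. *)
Lemma prime_end_RSP : prime_end dist Om E -> RSP_end dist Om E.
Proof.
move=> pE; have iE : impression dist E = [set z].
  rewrite predeqE => x; split => [Ix|->]; last exact: gam_end_impression.
  apply: component_impression => l _; have [k kl] := pE.2 _ chain_component component_divides l.
  exact: dclosureS kl _ (Ix k Logic.I).
split => //; split; first by exists z.
exists gam; split; first exact: gam_rect_curve01.
by split => //; split => // k; exact: curve_tail.
Qed.

End EndCurve.
End PrimeEnds.

(** * Test functions built from the weighted distance, and the vanishing of the capacity *)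

Section Capacity.
Context {R : realType} {dX : measure_display} {X : measurableType dX}.
Variable dist : X -> X -> R.
Hypothesis metricd : is_metric dist.
Variables (mu : {measure set X -> \bar R}) (p : R).
Hypotheses (p_gt1 : 1 < p) (borelmu : completed_borel dist mu) (doublingmu : doubling dist mu).
Variables (C : R) (Om : set X) (h : X -> \bar R) (x0 : X).
Hypotheses (C_ge1 : 1 <= C) (qc : locally_quasiconvex dist C).
Hypotheses (openOm : dopen dist Om) (connOm : dconnected dist Om) (Omx0 : Om x0).
Hypotheses (boundedOm : dbounded dist Om).
Hypotheses (h_ge0 : forall x, (0 <= h x)%E) (borel_h : borel_efun dist h).
Hypothesis h_bnd : forall x, Om x -> exists2 r : R, 0 < r &
        exists M : R, forall y, dist x y < r -> (h y <= M%:E)%E.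
Hypothesis h_lp : (\int[mu]_(x in Om) (h x `^ p) < +oo)%E.
Hypothesis h_oo : forall M : R, exists2 s : R, 0 < s &
  forall x, near_compl dist Om s x -> (M%:E <= h x)%E.

Local Notation wd := (wdist dist Om h x0).

Lemma powR_le_id (a : R) : 0 <= a <= 1 -> a `^ p <= a.
Proof.
move=> /andP[]; rewrite le_eqVlt => /orP[/eqP <- _|a0 a1].
  by rewrite powR0 // gt_eqF // (lt_trans _ p_gt1).
by rewrite -[leRHS]powRr1 ?(ltW a0) // ger_powR ?a0 //; exact: ltW.
Qed.

Definition cutoff (n : nat) (x : X) : R := Num.min 1 (wd x / n.+1%:R).

Lemma wd_ge0 x : Om x -> 0 <= wd x.
Proof. exact: (wdist_ge0 metricd C_ge1 qc openOm connOm Omx0 h_ge0 borel_h h_bnd). Qed.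

Lemma cutoff_itv n x : Om x -> 0 <= cutoff n x <= 1.
Proof. by move=> Ox; rewrite /cutoff ge_min lexx le_min ler01 divr_ge0 // wd_ge0. Qed.

Lemma measurable_cutoff n : measurable_fun Om (cutoff n).
Proof.
apply: measurable_minr => //; apply: measurable_funM => //.
apply: (measurable_fun_dcontinuous borelmu openOm).
exact: (wdist_continuous metricd C_ge1 qc openOm connOm Omx0 h_ge0 borel_h h_bnd).
Qed.

Lemma cutoff_lip n x y : `|cutoff n x - cutoff n y| <= `|wd x - wd y| * n.+1%:R^-1.
Proof.
rewrite -[X in _ * X]ger0_norm // -normrM mulrBl /cutoff.
move: (wd x / _) (wd y / _) => a b; rewrite /Num.min.
by do ![case: ifP]; move=> *; rewrite ler_norml; apply/andP; split; case: (ler0P (a - b)); lra.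
Qed.

Lemma cutoff_upper_gradient n :
  upper_gradient dist Om (cutoff n) (fun x => h x * (n.+1%:R^-1)%:E)%E.
Proof.
split; first by move=> x; rewrite mule_ge0 // lee_fin.
split.
  by apply/borel_efunP; apply: emeasurable_funM => //; exact/borel_efunP.
move=> gam l al Og; have [l0 _] := al; have l0' := ltW l0.
(* Nothing is known about [gam] off [[0, l]]; clamping turns it into a curve defined on the whole
   line inside [Om]. *)
pose f := gam \o clamp l.
have lf : lip1 dist f by apply: lip1_clamp => //; exact: arclength_lip.
have Of s : Om (f s) by apply: Og; exact: clamp_itv.
have -> : gam 0 = f 0 by rewrite /f /= clamp_id // lexx.
have -> : gam l = f l by rewrite /f /= clamp_id // lexx andbT.
have -> : line_int (fun x => h x * (n.+1%:R^-1)%:E)%E gam l = (line_int h f l * (n.+1%:R^-1)%:E)%E.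
  rewrite /line_int -ge0_integralZr //; last first.
    by apply: measurable_funTS; exact: (measurable_borel_comp_lip1 borel_h lf).
  by apply: eq_integral => s; rewrite inE /= in_itv /= => hs; rewrite /f /= clamp_id.
apply: (@le_trans _ _ (`|wd (f 0) - wd (f l)|%:E * (n.+1%:R^-1)%:E)%E).
  by rewrite -EFinM lee_fin cutoff_lip.
apply: lee_wpmul2r; first by rewrite lee_fin.
exact: (wdist_curve metricd C_ge1 qc openOm connOm Omx0 h_ge0 borel_h h_bnd).
Qed.

Lemma measurable_Om : measurable Om.
Proof. exact: (measurable_dopen borelmu). Qed.

Lemma measurable_hp : measurable_fun Om (fun x => h x `^ p)%E.
Proof.
apply: (@measurableT_comp _ _ _ _ _ _ (fun y => y `^ p)%E); first exact: measurable_poweR.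
exact: (measurable_borel_efun borelmu).
Qed.

(** The factor is [n.+1%:R^-1] to the power [p], at most its base because [p > 1]; the weaker factor
    still tends to 0. *)
Lemma cutoff_gradient_norm n :
  (\int[mu]_(x in Om) ((h x * (n.+1%:R^-1)%:E) `^ p) <=
   (n.+1%:R^-1)%:E * \int[mu]_(x in Om) (h x `^ p))%E.
Proof.
rewrite -ge0_integralZl //; last 3 first.
- exact: measurable_Om.
- exact: measurable_hp.
- by move=> x _; exact: poweR_ge0.
apply: ge0_le_integral.
- exact: measurable_Om.
- by move=> x _; exact: poweR_ge0.
- apply: (@measurableT_comp _ _ _ _ _ _ (fun y => y `^ p)%E); first exact: measurable_poweR.
  by apply: emeasurable_funM => //; exact: (measurable_borel_efun borelmu).
- by apply: emeasurable_funM => //; exact: measurable_hp.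
move=> x _; rewrite poweRM ?lee_fin // muleC; apply: lee_wpmul2r; first exact: poweR_ge0.
rewrite poweR_EFin lee_fin; apply: powR_le_id; rewrite invr_ge0 ler0n /=.
by rewrite invf_le1 // ler1n.
Qed.

Lemma cutoff_norm_le n :
  (\int[mu]_(x in Om) (`|cutoff n x| `^ p)%:E <= \int[mu]_(x in Om) (cutoff n x)%:E)%E.
Proof.
apply: ge0_le_integral.
- exact: measurable_Om.
- by move=> x _; rewrite lee_fin powR_ge0.
- apply/measurable_EFinP; apply: (@measurableT_comp _ _ _ _ _ _ (fun y => y `^ p)).
    exact: measurable_powR.
  by apply: measurableT_comp => //; exact: measurable_cutoff.
- by apply/measurable_EFinP; exact: measurable_cutoff.
move=> x Ox; have /andP[u0 u1] := cutoff_itv n Ox.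
by rewrite lee_fin ger0_norm // powR_le_id // u0.
Qed.

(** Dominated convergence: the constant 1 is integrable on [Om], of finite mass, and
    [wd x / n.+1%:R] tends to 0 since [wd x] is a real number. *)
Lemma cutoff_integral_cvg :
  (\int[mu]_(x in Om) (cutoff n x)%:E)%E @[n --> \oo] --> (0%E : \bar R).
Proof.
have -> : (0%E : \bar R) = (\int[mu]_(x in Om) (cst 0%E x))%E by rewrite integral0.
apply: (@dominated_cvg _ _ _ _ _ measurable_Om _ _ (cst 1%E)) => //.
- by move=> n; apply/measurable_EFinP; exact: measurable_cutoff.
- move=> x Ox; apply: cvg_EFin; first by near=> n.
  apply/cvgrPdist_lt => e e0; near=> n; rewrite /= sub0r normrN.
  have /andP[u0 u1] := cutoff_itv n Ox; rewrite ger0_norm //.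
  apply: (@le_lt_trans _ _ (wd x / n.+1%:R)); first by rewrite /cutoff ge_min lexx orbT.
  rewrite ltr_pdivrMr // mulrC -ltr_pdivrMr //.
  apply: lt_le_trans (truncnS_gt (wd x / e)) _; rewrite ler_nat ltnS.
  by near: n; exact: nbhs_infty_ge.
- have -> : (cst 1%E : X -> \bar R) = EFin \o cst 1 by [].
  apply: measurable_bounded_integrable => //; first exact: measurable_Om.
    exact: (mu_Om_lty metricd borelmu doublingmu openOm boundedOm).
  by exists 1; split; [exact: num_real|move=> M M1 y _; rewrite /= normr1 ltW].
- move=> n x Ox; have /andP[u0 u1] := cutoff_itv n Ox.
  by rewrite gee0_abs ?lee_fin.
Unshelve. all: by end_near. Qed.

Lemma in_N1p_cutoff n : in_N1p dist mu p Om (cutoff n).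
Proof.
split; first exact: measurable_cutoff.
split.
  apply: le_lt_trans (cutoff_norm_le n) _.
  apply: (@le_lt_trans _ _ (\int[mu]_(x in Om) (cst 1%E x))%E).
    apply: ge0_le_integral => //; first exact: measurable_Om.
    - by move=> x /(cutoff_itv n) /andP[? _]; rewrite lee_fin.
    - by apply/measurable_EFinP; exact: measurable_cutoff.
    - by move=> x /(cutoff_itv n) /andP[_ ?]; rewrite lee_fin.
  rewrite integral_cst ?mul1e; last exact: measurable_Om.
  exact: (mu_Om_lty metricd borelmu doublingmu openOm boundedOm).
exists (fun x => h x * (n.+1%:R^-1)%:E)%E; split; first exact: cutoff_upper_gradient.
apply: le_lt_trans (cutoff_gradient_norm n) _.
by apply: lte_mul_pinfty; rewrite ?lee_fin.
Qed.

Lemma cutoff_normp_le n : (N1p_normp dist mu p Om (cutoff n) <=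
  \int[mu]_(x in Om) (cutoff n x)%:E + (n.+1%:R^-1)%:E * \int[mu]_(x in Om) (h x `^ p))%E.
Proof.
apply: leeD; first exact: cutoff_norm_le.
apply: ge_ereal_inf; eexists; last exact: cutoff_gradient_norm.
by eexists; split; first exact: cutoff_upper_gradient.
Qed.

Lemma cutoff_normp_small (e : R) : 0 < e ->
  exists n, (N1p_normp dist mu p Om (cutoff n) <= e%:E)%E.
Proof.
move=> e0; have e20 : 0 < e / 2 by lra.
have oe : nbhs (0%E : \bar R) [set y : \bar R | (y < (e / 2)%:E)%E].
  by apply: open_nbhs_nbhs; split; [exact: open_ereal_lt_ereal|rewrite /= lte_fin].
have [N _ NP] := cutoff_integral_cvg oe.
have A0 : (0 <= \int[mu]_(x in Om) (h x `^ p))%E by apply: integral_ge0 => x _; exact: poweR_ge0.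
have fA : (\int[mu]_(x in Om) (h x `^ p))%E \is a fin_num by rewrite ge0_fin_numE.
pose A := fine (\int[mu]_(x in Om) (h x `^ p))%E.
pose n := maxn N (Num.truncn (A / (e / 2))); exists n.
apply: le_trans (cutoff_normp_le n) _.
have -> : e%:E = ((e / 2)%:E + (e / 2)%:E)%E by rewrite -EFinD; congr (_%:E); lra.
apply: leeD; first by apply: ltW; apply: NP; exact: leq_maxl.
rewrite -(fineK fA) -/A -EFinM lee_fin mulrC ler_pdivrMr // mulrC -ler_pdivrMr //.
apply: ltW; apply: lt_le_trans (truncnS_gt _) _.
by rewrite ler_nat ltnS leq_maxr.
Qed.

Lemma near_compl_center : exists2 s : R, 0 < s & ~ near_compl dist Om s x0.
Proof.
have [s s0 sO] := openOm Omx0; exists s => // -[_ [y Oy xy]].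
by apply: Oy; exact: sO.
Qed.

Hypothesis completed : dcomplete dist.

(** If every [E m] contained a point with [wd] below [L], joining such points would produce a curve
    to which [prime_end_RSP] applies. *)
Lemma calF_wdist_large E (L : R) : 0 < L -> calF dist Om E ->
  exists m, forall x, E m x -> L <= wd x.
Proof.
move=> L0 [pE nE]; have chE := pE.1; apply: contrapT => H; apply: nE.
have /choice [x xP] : forall m, exists x, E m x /\ wd x < L.
  move=> m; apply: contrapT => Hm; apply: H; exists m => x Ex.
  by rewrite leNgt; apply/negP => xL; apply: Hm; exists x.
have tbO : tot_bounded dist Om.
  move=> e e0; have [a [r Or]] := boundedOm.
  have [n [c cP]] := @tot_bounded_dball _ _ _ _ metricd _ borelmu doublingmu a r e e0.
  by exists n, c => y /Or /cP.
have [e e0|m [mj inn]] := @inner_subsequence _ _ _ _ metricd Om C openOm C_ge1 qc x completed tbO.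
  (* A cost below [L] then allows length at most [L / M = e] inside the collar; [s2] keeps the base
     point out of it. *)
  pose M := L / e; have M0 : 0 < M by rewrite divr_gt0.
  have [s1 s10 s1P] := h_oo M; have [s2 s20 s2P] := near_compl_center.
  exists (Num.min s1 s2); first by rewrite lt_min s10.
  move=> n; have [Ex xL] := xP n; have Ox := chain_sub chE Ex.
  have [c xc cL] := wdist_lt metricd C_ge1 qc openOm connOm Omx0 h_ge0 borel_h h_bnd Ox xL.
  have [||y [Oy ny yx]] := @reach_deep _ _ _ _ metricd Om h x0
    Omx0 h_ge0 borel_h M (Num.min s1 s2) _ _ M0 _ _ xc.
  - by move=> y yn; apply: s1P; apply: near_complS yn; rewrite ge_min lexx.
  - by move=> x0n; apply: s2P; apply: near_complS x0n; rewrite ge_min lexx orbT.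
  exists y; split => //; apply: (inner_le metricd _ yx).
  rewrite ler_pdivrMr // /M mulrC divfK ?gt_eqF //; exact: ltW.
have [gam [lg [Og gw]]] := concat_curve metricd completed inn.
apply: (@prime_end_RSP _ _ _ _ metricd Om C openOm qc E gam chE lg Og _ x0 Omx0 pE).
move=> j; rewrite gw; apply: (chain_le chE (mj j)).
by have [] := xP (m j).
Qed.

Theorem pe_cap_calF : pe_cap dist mu p Om (calF dist Om) = 0%E.
Proof.
apply/eqP; rewrite eq_le; apply/andP; split; last first.
  apply: le_ereal_inf_tmp => _ [u [_ [_ ->]]]; apply: adde_ge0.
    by apply: integral_ge0 => x _; rewrite lee_fin powR_ge0.
  by apply: le_ereal_inf_tmp => _ [g [_ ->]]; apply: integral_ge0 => x _; exact: poweR_ge0.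
apply/lee_addgt0Pr => e e0; rewrite add0e.
have [n ne] := cutoff_normp_small e0; apply: ge_ereal_inf; eexists; last exact: ne.
exists (cutoff n); split; first exact: in_N1p_cutoff.
split => // E FE; have chE := FE.1.1.
have [//|m mP] := @calF_wdist_large E n.+1%:R _ FE.
(* The interior of [E m] is an admissible neighbourhood of the end, as it contains [E m.+1], and
   [cutoff n] equals 1 on it because [wd] is at least [n.+1%:R] there. *)
apply: (@le_trans _ _ (ereal_inf [set (cutoff n y)%:E | y in dinterior dist (E m)])).
  apply: le_ereal_inf_tmp => _ [y /(dinterior_sub metricd) Ey <-].
  rewrite lee_fin /cutoff le_min lexx /= ler_pdivlMr // mul1r; exact: mP.
apply: ereal_sup_ubound; exists (dinterior dist (E m)); split; first exact: dopen_dinterior.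
split; first by move=> y /(dinterior_sub metricd) Ey; exact: (chain_sub chE Ey).
by split => //; exists m.+1; exact: (chain_interior metricd chE).
Qed.

End Capacity.

Theorem theorem3p3 (R : realType) (dX : measure_display) (X : measurableType dX)
  (dist : X -> X -> R) (mu : {measure set X -> \bar R}) (p : R) (Om : set X) :
  1 < p ->
  is_metric dist -> dcomplete dist ->
  completed_borel dist mu -> doubling dist mu -> poincare dist mu p ->
  dopen dist Om -> dconnected dist Om -> Om !=set0 -> dbounded dist Om -> Om <> setT ->
  (0 < sobolev_cap dist mu p (~` Om))%E ->
  ends_lower_bound dist Om ->
  pe_cap dist mu p Om (calF dist Om) = 0%E.
Proof.
move=> p1 metricd completed borelmu doublingmu poincarep openOm connOm [x0 Omx0] boundedOm _ _ _.
have [C [C1 HC]] := quasiconvex metricd borelmu doublingmu poincarep completed.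
have qc := quasiconvex_locally metricd C1 HC.
have p0 : 0 < p by exact: lt_trans p1.
have [h [h0 bh hp hoo hb]] := boundary_weight metricd borelmu doublingmu openOm boundedOm p0.
exact: (pe_cap_calF metricd p1 borelmu doublingmu C1 qc openOm connOm
  Omx0 boundedOm h0 bh hb hp hoo completed).
Qed.
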